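(* Assume (A1), (A2), (A3) (see context). Let the parameters satisfy $\theta_i\in(0,2)$, $\alpha_i>0$, $\gamma_i>0$ and $0<\gamma_i\beta<1/\lambda_{\max}(L)$ for all $i=1,\dots,m$, and let the precisions satisfy $\sum_{k=0}^\infty\varepsilon_i^k<\infty$ for all $i$. Let $\{\xi^k\}_{k\ge0}$, $\{\widehat\xi^k\}_{k\ge0}$ and $\{V^k\}_{k\ge0}$ be generated by the inexact DPMM algorithm described in the context. Then: (a) for every $\xi^*=\mathrm{col}(\mathrm{x}^*,\mathrm{Y}^*,\mathrm{Z}^* )\in\Phi^{-1}(0)$ and every $k\ge0$, $$\|\xi^{k+1}-\xi^*\|_{\mathbf H}^2\le\|\xi^k-\xi^*\|_{\mathbf H}^2-\|\xi^k-\widehat\xi^k\|_{\mathbf D}^2+2\langle\widehat\xi^k-\xi^*,V^k\rangle;$$ (b) the sequence $\{\xi^k\}_{k\ge0}$ is bounded; (c) $\{\xi^k\}_{k\ge0}$ converges to some $\xi^\infty=\mathrm{col}(\mathrm{x}^\infty,\mathrm{Y}^\infty,\mathrm{Z}^\infty)\in\Phi^{-1}(0)$; in particular $\mathrm{x}^\infty$ is an optimal solution of (P), $\mathrm{Y}^\infty=\mathbf 1_m\otimes\mathrm{y}^\infty$ for some $\mathrm{y}^\infty\in\mathbb R^{p+q}$, and $\mathrm{y}^\infty$ is an optimal solution of (D).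
   Context: Problem. Let $m\ge2$, $n_1,\dots,n_m\ge1$, $p,q\ge0$ be integers, $n=\sum_i n_i$, $\mathcal V=\{1,\dots,m\}$. For $i\in\mathcal V$ let $f_i:\mathbb R^{n_i}\to\mathbb R$, $A_i\in\mathbb R^{p\times n_i}$, $b_i\in\mathbb R^p$, $g_i:\mathbb R^{n_i}\to\mathbb R^q$, $\Omega_i\subseteq\mathbb R^{n_i}$, and $G_i(\mathrm x_i)=\mathrm{col}(A_i\mathrm x_i-b_i,\,g_i(\mathrm x_i))\in\mathbb R^{p+q}$. Let $\mathcal K=\{0_p\}\times\mathbb R^q_-$ and $\mathcal K^\circ=\mathbb R^p\times\mathbb R^q_+$. Problem (P): minimize $F(\mathrm x)=\sum_i f_i(\mathrm x_i)$ over $\mathrm x=\mathrm{col}(\mathrm x_1,\dots,\mathrm x_m)\in\mathbb R^n$ subject to $\sum_iG_i(\mathrm x_i)\in\mathcal K$ and $\mathrm x_i\in\Omega_i$ for all $i$. With $\delta_S$ the indicator function of a set $S$ ($0$ on $S$, $+\infty$ off $S$), put $\ell_i(\mathrm x_i,\mathrm y)=f_i(\mathrm x_i)+\mathrm y^\top G_i(\mathrm x_i)+\delta_{\Omega_i}(\mathrm x_i)-\delta_{\mathcal K^\circ}(\mathrm y)$ for $\mathrm y\in\mathbb R^{p+q}$. Dual problem (D): maximize $\varphi(\mathrm y)=\sum_i\inf_{\mathrm x_i}\ell_i(\mathrm x_i,\mathrm y)$ over $\mathrm y\in\mathbb R^{p+q}$. Assumptions. (A1) $\mathcal G=(\mathcal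 V,\mathcal E)$ is a connected undirected graph; $L\in\mathbb R^{m\times m}$ is symmetric and compatible with $\mathcal G$ (i.e. $L_{ij}=0$ whenever $i\ne j$ and $(i,j)\notin\mathcal E$, and $\mathrm{null}(L)=\mathrm{span}\{\mathbf 1_m\}$), and $L=U^\top U$ for a full-row-rank matrix $U\in\mathbb R^{r\times m}$ with $U\mathbf 1_m=0$. (A2) each $f_i$ and each component of $g_i$ is a proper closed convex function, each $\Omega_i$ is a nonempty closed convex set, and the optimal solution set of (P) is nonempty. (A3) (Slater) there is $\bar{\mathrm x}$ with $\bar{\mathrm x}_i\in\mathrm{int}(\Omega_i)$ for all $i$, $\sum_i(A_i\bar{\mathrm x}_i-b_i)=0$ and $\sum_ig_i(\bar{\mathrm x}_i)<0$ componentwise. Operator. $\mathbf L=L\otimes I_{p+q}$, $\mathbf U=U\otimes I_{p+q}\in\mathbb R^{r(p+q)\times m(p+q)}$. For $\mathrm x\in\mathbb R^n$ and $\mathrm Y=\mathrm{col}(\mathrm y_1,\dots,\mathrm y_m)$, $\mathrm y_i\in\mathbb R^{p+q}$, let $\mathcal L(\mathrm x,\mathrm Y)=\sum_i\ell_i(\mathrm x_i,\mathrm y_i)$; $\partial_{\mathrm x}\mathcal L$ is the convex subdifferential in $\mathrm x$ and $\partial_{\mathrm Y}\mathcal L(\mathrm x,\mathrm Y):=-\partial_{\mathrm Y}[-\mathcal L(\mathrm x,\mathrm Y)]$. For $\mathrm Z\in\mathbb R^{r(p+q)}$ define the set-valued map $\Phi(\mathrm x,\mathrm Y,\mathrm Z)=\partial_{\mathrm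 x}\mathcal L(\mathrm x,\mathrm Y)\times\big(-\partial_{\mathrm Y}\mathcal L(\mathrm x,\mathrm Y)+\mathbf U^\top\mathrm Z\big)\times\{-\mathbf U\mathrm Y\}$, and $\Phi^{-1}(0)$ its zero set. Matrices. Parameters $\theta_i,\alpha_i,\gamma_i>0$ ($i\in\mathcal V$) and $\beta>0$; $\Theta=\mathrm{diag}(\theta_iI_{n_i})_i$, $\Upsilon=\mathrm{diag}(\alpha_iI_{n_i})_i$, $\Gamma=\mathrm{diag}(\gamma_iI_{p+q})_i$; $Q=\begin{pmatrix}\Upsilon^{-1}&0&0\\0&\Gamma^{-1}&-\mathbf U^\top\\0&0&\frac1\beta I\end{pmatrix}$, $M=\begin{pmatrix}\Theta&0&0\\0&I&-\Gamma\mathbf U^\top\\0&0&I\end{pmatrix}$ (identities of sizes $m(p+q)$ and $r(p+q)$ as appropriate), $\mathbf H=QM^{-1}$, $\mathbf D=Q^\top+Q-M^\top\mathbf HM$, $\|v\|_{\mathbf H}=\sqrt{\langle v,\mathbf Hv\rangle}$. Algorithm (inexact DPMM). $\mathcal P_{\mathcal K^\circ}(u_1,u_2)=(u_1,\max(u_2,0))$ for $(u_1,u_2)\in\mathbb R^p\times\mathbb R^q$. Initialize $\mathrm x_i^0\in\Omega_i$, $\mathrm y_i^0\in\mathcal K^\circ$, $\lambda_i^0=0\in\mathbb R^{p+q}$. At iteration $k$, each agent $i$ chooses $\varepsilon_i^k\ge0$, sets $\phi_i^k(\mathrm x_i,\mathrm y_i)=f_i(\mathrm x_i)+\frac1{2\gamma_i}(\|\mathcal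 P_{\mathcal K^\circ}(\mathrm y_i+\gamma_iG_i(\mathrm x_i))\|^2-\|\mathrm y_i\|^2)+\frac1{2\alpha_i}\|\mathrm x_i-\mathrm x_i^k\|^2+\delta_{\Omega_i}(\mathrm x_i)$, computes $\widehat{\mathrm x}_i^k$ and $v_i^k\in\partial_{\mathrm x_i}\phi_i^k(\widehat{\mathrm x}_i^k,\mathrm y_i^k-\gamma_i\lambda_i^k)$ with $\|v_i^k\|\le\varepsilon_i^k$, and sets $\widehat{\mathrm y}_i^k=\mathcal P_{\mathcal K^\circ}(\mathrm y_i^k-\gamma_i\lambda_i^k+\gamma_iG_i(\widehat{\mathrm x}_i^k))$, $\mathrm x_i^{k+1}=(1-\theta_i)\mathrm x_i^k+\theta_i\widehat{\mathrm x}_i^k$, $\lambda_i^{k+1}=\lambda_i^k+\beta\sum_jL_{ij}\widehat{\mathrm y}_j^k$, $\mathrm y_i^{k+1}=\widehat{\mathrm y}_i^k+\gamma_i(\lambda_i^k-\lambda_i^{k+1})$. Stack $\mathrm x^k,\mathrm Y^k,\Lambda^k=\mathrm{col}(\lambda_i^k)_i,\widehat{\mathrm x}^k,\widehat{\mathrm Y}^k$. Let $\mathrm Z^k\in\mathbb R^{r(p+q)}$ be the (unique) vector with $\Lambda^k=\mathbf U^\top\mathrm Z^k$ and $\widehat{\mathrm Z}^k$ the one with $\Lambda^{k+1}=\mathbf U^\top\widehat{\mathrm Z}^k$; $\xi^k=\mathrm{col}(\mathrm x^k,\mathrm Y^k,\mathrm Z^k)$, $\widehat\xi^k=\mathrm{col}(\widehat{\mathrm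 x}^k,\widehat{\mathrm Y}^k,\widehat{\mathrm Z}^k)$, $V^k=\mathrm{col}(v_1^k,\dots,v_m^k,0,0)$. *)

(* Defs.v *)
From HB Require Import structures.
From mathcomp Require Import all_boot all_order all_algebra.
From mathcomp Require Import all_classical all_reals all_analysis.

Set Implicit Arguments.
Unset Strict Implicit.
Unset Printing Implicit Defensive.

Import Order.TTheory GRing.Theory Num.Theory.
Import numFieldNormedType.Exports.

Local Open Scope classical_set_scope.
Local Open Scope ring_scope.

Section DPMM.
Variable R : realType.

Definition inner {N : nat} (u v : 'cV[R]_N) : R := \sum_(i < N) u i 0 * v i 0.
Definition enorm {N : nat} (u : 'cV[R]_N) : R := Num.sqrt (inner u u).
Definition sqnormA {N : nat} (A : 'M[R]_N) (v : 'cV[R]_N) : R := inner v (A *m v).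

Definition convex_fun {N : nat} (h : 'cV[R]_N -> R) : Prop :=
  forall (u v : 'cV[R]_N) (t : R), 0 <= t -> t <= 1 ->
    h (t *: u + (1 - t) *: v) <= t * h u + (1 - t) * h v.
Definition closed_fun {N : nat} (h : 'cV[R]_N -> R) : Prop :=
  lower_semicontinuous (fun u => (h u)%:E).
Definition convex_set_cV {N : nat} (S : set 'cV[R]_N) : Prop :=
  forall (u v : 'cV[R]_N) (t : R), S u -> S v -> 0 <= t -> t <= 1 ->
    S (t *: u + (1 - t) *: v).
Definition indic {T : Type} (S : set T) (x : T) : \bar R :=
  if `[< S x >] then 0%E else +oo%E.
Definition subdiff {N : nat} (h : 'cV[R]_N -> \bar R) (x : 'cV[R]_N) : set 'cV[R]_N :=
  [set w | h x \is a fin_num /\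
           forall z, (h x + (inner w (z - x))%:E <= h z)%E].

Definition Kcone (p q : nat) : set 'cV[R]_(p + q) :=
  [set u | usubmx u = 0 /\ forall j, dsubmx u j 0 <= 0].
Definition Kpolar (p q : nat) : set 'cV[R]_(p + q) :=
  [set u | forall j, 0 <= dsubmx u j 0].
Definition projKpolar (p q : nat) (u : 'cV[R]_(p + q)) : 'cV[R]_(p + q) :=
  col_mx (usubmx u) (map_mx (fun a => Num.max a 0) (dsubmx u)).

Definition lambda_max {m : nat} (L : 'M[R]_m) : R := sup [set a : R | eigenvalue L a].

End DPMM.
Arguments indic {R T}.
Arguments Kcone {R p q}.
Arguments Kpolar {R p q}.
Arguments projKpolar {R p q}.

Unset Implicit Arguments.
Record Problem (R : realType) := {
  pm : nat;                                   (* number of agents m *)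
  pn : 'I_pm -> nat;
  pp : nat;
  pq : nat;
  pf : forall i : 'I_pm, 'cV[R]_(pn i) -> R;
  pA : forall i : 'I_pm, 'M[R]_(pp, pn i);
  pb : 'I_pm -> 'cV[R]_pp;
  pg : forall i : 'I_pm, 'cV[R]_(pn i) -> 'cV[R]_pq;
  pOmega : forall i : 'I_pm, set 'cV[R]_(pn i)
}.
Arguments pm {R}. Arguments pn {R}. Arguments pp {R}. Arguments pq {R}.
Arguments pf {R}. Arguments pA {R}. Arguments pb {R}. Arguments pg {R}. Arguments pOmega {R}.
Set Implicit Arguments.

Section ProblemDefs.
Variables (R : realType) (P : Problem R).

Local Notation m := (pm P).
Local Notation d := (pp P + pq P)%N.

Definition nx : nat := (\sum_(i < m) pn P i)%N.
Definition ny : nat := (\sum_(i < m) d)%N.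
Definition nz (r : nat) : nat := (\sum_(j < r) d)%N.

Definition xblk (x : 'cV[R]_nx) (i : 'I_m) : 'cV[R]_(pn P i) :=
  @submxcol R m (pn P) 1 x i.
Definition yblk (Y : 'cV[R]_ny) (i : 'I_m) : 'cV[R]_d :=
  @submxcol R m (fun _ => d) 1 Y i.
Definition ones_kron (y : 'cV[R]_d) : 'cV[R]_ny :=
  @mxcol R m (fun _ => d) 1 (fun _ => y).

Definition Gi (i : 'I_m) (xi : 'cV[R]_(pn P i)) : 'cV[R]_d :=
  col_mx (pA P i *m xi - pb P i) (pg P i xi).

Definition Fobj (x : 'cV[R]_nx) : R := \sum_(i < m) pf P i (xblk x i).
Definition feasible (x : 'cV[R]_nx) : Prop :=
  Kcone (\sum_(i < m) Gi (xblk x i)) /\ forall i, pOmega P i (xblk x i).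
Definition primal_optimal (x : 'cV[R]_nx) : Prop :=
  feasible x /\ forall x' : 'cV[R]_nx, feasible x' -> Fobj x <= Fobj x'.

Definition ell (i : 'I_m) (xi : 'cV[R]_(pn P i)) (y : 'cV[R]_d) : \bar R :=
  ((pf P i xi + inner y (Gi xi))%:E + indic (pOmega P i) xi
     - indic (@Kpolar R (pp P) (pq P)) y)%E.
Definition dual_fun (y : 'cV[R]_d) : \bar R :=
  (\sum_(i < m) ereal_inf [set ell xi y | xi in [set: 'cV[R]_(pn P i)]])%E.
Definition dual_optimal (y : 'cV[R]_d) : Prop :=
  forall y' : 'cV[R]_d, (dual_fun y' <= dual_fun y)%E.

Definition Lag (x : 'cV[R]_nx) (Y : 'cV[R]_ny) : \bar R :=
  (\sum_(i < m) ell (xblk x i) (yblk Y i))%E.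
Definition dxLag (x : 'cV[R]_nx) (Y : 'cV[R]_ny) : set 'cV[R]_nx :=
  subdiff (fun x' => Lag x' Y) x.
Definition dYLag (x : 'cV[R]_nx) (Y : 'cV[R]_ny) : set 'cV[R]_ny :=
  [set - w | w in subdiff (fun Y' => (- Lag x Y')%E) Y].

(** bold U = U (x) I_{p+q} *)
Definition Ubold (r : nat) (U : 'M[R]_(r, m)) : 'M[R]_(nz r, ny) :=
  @mxblock R r m (fun _ => d) (fun _ => d) (fun j i => (U j i)%:M).

Definition Phi (r : nat) (U : 'M[R]_(r, m)) (x : 'cV[R]_nx) (Y : 'cV[R]_ny)
    (Z : 'cV[R]_(nz r)) : set 'cV[R]_(nx + (ny + nz r)) :=
  [set t | exists a b c, [/\ t = col_mx a (col_mx b c), dxLag x Y a,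
     (exists2 w, dYLag x Y w & b = - w + (Ubold U)^T *m Z) & c = - (Ubold U *m Y)]].
Definition Phi_zeros (r : nat) (U : 'M[R]_(r, m)) : set 'cV[R]_(nx + (ny + nz r)) :=
  [set xi | Phi U (usubmx xi) (usubmx (dsubmx xi)) (dsubmx (dsubmx xi)) 0].

Definition stack (r : nat) (x : 'cV[R]_nx) (Y : 'cV[R]_ny) (Z : 'cV[R]_(nz r))
  : 'cV[R]_(nx + (ny + nz r)) := col_mx x (col_mx Y Z).

Definition Theta_mx (theta : 'I_m -> R) : 'M[R]_nx :=
  @mxdiag R m (pn P) (fun i => (theta i)%:M).
Definition Ups_mx (alpha : 'I_m -> R) : 'M[R]_nx :=
  @mxdiag R m (pn P) (fun i => (alpha i)%:M).
Definition Gam_mx (gamma : 'I_m -> R) : 'M[R]_ny :=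
  @mxdiag R m (fun _ => d) (fun i => (gamma i)%:M).

Definition Q_mx (r : nat) (U : 'M[R]_(r, m)) (alpha gamma : 'I_m -> R) (beta : R)
  : 'M[R]_(nx + (ny + nz r)) :=
  block_mx (invmx (Ups_mx alpha)) 0 0
    (block_mx (invmx (Gam_mx gamma)) (- (Ubold U)^T) 0 (beta^-1)%:M).
Definition M_mx (r : nat) (U : 'M[R]_(r, m)) (theta gamma : 'I_m -> R)
  : 'M[R]_(nx + (ny + nz r)) :=
  block_mx (Theta_mx theta) 0 0
    (block_mx 1%:M (- (Gam_mx gamma *m (Ubold U)^T)) 0 1%:M).
Definition H_mx r U theta alpha gamma beta : 'M[R]_(nx + (ny + nz r)) :=
  Q_mx U alpha gamma beta *m invmx (M_mx U theta gamma).
Definition D_mx r U theta alpha gamma beta : 'M[R]_(nx + (ny + nz r)) :=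
  (Q_mx U alpha gamma beta)^T + Q_mx U alpha gamma beta
  - (M_mx U theta gamma)^T *m @H_mx r U theta alpha gamma beta *m M_mx U theta gamma.

Definition phik (i : 'I_m) (alpha gamma : 'I_m -> R) (xk : 'cV[R]_(pn P i))
    (y : 'cV[R]_d) (xi : 'cV[R]_(pn P i)) : \bar R :=
  ((pf P i xi
     + (2 * gamma i)^-1 * (enorm (projKpolar (y + gamma i *: Gi xi)) ^+ 2 - enorm y ^+ 2)
     + (2 * alpha i)^-1 * enorm (xi - xk) ^+ 2)%:E
   + indic (pOmega P i) xi)%E.

Definition inexact_DPMM (r : nat) (U : 'M[R]_(r, m)) (L : 'M[R]_m)
    (theta alpha gamma : 'I_m -> R) (beta : R) (eps : 'I_m -> nat -> R)
    (x xh v : nat -> 'cV[R]_nx) (Y Yh Lam : nat -> 'cV[R]_ny)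
    (Z Zh : nat -> 'cV[R]_(nz r)) : Prop :=
  [/\ (forall i, pOmega P i (xblk (x 0%N) i)),
      (forall i, Kpolar (yblk (Y 0%N) i)),
      Lam 0%N = 0 &
      forall (k : nat) (i : 'I_m),
      [/\ 0 <= eps i k,
          subdiff (phik alpha gamma (xblk (x k) i)
                        (yblk (Y k) i - gamma i *: yblk (Lam k) i))
                  (xblk (xh k) i) (xblk (v k) i) &
          enorm (xblk (v k) i) <= eps i k]
      /\ [/\ yblk (Yh k) i = projKpolar (yblk (Y k) i - gamma i *: yblk (Lam k) i
                                      + gamma i *: Gi (xblk (xh k) i)),
          xblk (x k.+1) i = (1 - theta i) *: xblk (x k) i + theta i *: xblk (xh k) i,
          yblk (Lam k.+1) i = yblk (Lam k) i
                              + beta *: \sum_(j < m) L i j *: yblk (Yh k) j &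
          yblk (Y k.+1) i = yblk (Yh k) i + gamma i *: (yblk (Lam k) i - yblk (Lam k.+1) i)]
      /\ (Lam k = (Ubold U)^T *m Z k /\ Lam k.+1 = (Ubold U)^T *m Zh k)].

End ProblemDefs.

(* Main.v *)
Require Import Defs.
From HB Require Import structures.
From mathcomp Require Import all_boot all_order all_algebra.
From mathcomp Require Import all_classical all_reals all_analysis.
From mathcomp Require Import ring lra.
Import Order.TTheory GRing.Theory Num.Theory.
Import numFieldNormedType.Exports.
Local Open Scope classical_set_scope.
Local Open Scope ring_scope.

Set Implicit Arguments.
Unset Strict Implicit.
Unset Printing Implicit Defensive.

(** A zero of [Phi] is the same as a saddle point: [x] in [Omega], [Y] in
    [K°^m], [U Y = 0], and [l(x, Y') <= l(x', Y) + <U Y', Z>] for all [x'] in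
    [Omega] and [Y'] in [K°^m], where [l] is the separable Lagrangian.

    The optimality conditions of one iteration are the same inequality at the
    predicted point, up to a term [<_, Q (xi - xih) + V>]; adding the two
    inequalities cancels the Lagrangians, and [H M = Q] turns the rest into the
    descent estimate.  [D] is positive definite because
    [|U^T z|^2 <= lambda_max(L) |z|^2].  A saddle point exists under Slater's
    condition: the scalar constraints are removed one at a time, each multiplier
    being a slope separating two subsets of the plane.  Hence the iterates are
    quasi-Fejer monotone with vanishing residual; a cluster point is a saddle
    point by lower semicontinuity, and Fejer monotonicity with respect to it
    gives convergence of the whole sequence. *)

Section InnerProduct.
Variable R : realType.

Lemma innerE N (u v : 'cV[R]_N) : inner u v = (u^T *m v) 0 0.
Proof. by rewrite mxE; apply: eq_bigr => i _; rewrite mxE. Qed.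

Lemma innerC N (u v : 'cV[R]_N) : inner u v = inner v u.
Proof. by apply: eq_bigr => i _; rewrite mulrC. Qed.

Lemma innerDl N (u v w : 'cV[R]_N) : inner (u + v) w = inner u w + inner v w.
Proof. by rewrite !innerE linearD/= mulmxDl mxE. Qed.

Lemma innerZl N a (u v : 'cV[R]_N) : inner (a *: u) v = a * inner u v.
Proof. by rewrite !innerE linearZ/= -scalemxAl mxE. Qed.

Lemma innerNl N (u v : 'cV[R]_N) : inner (- u) v = - inner u v.
Proof. by rewrite -scaleN1r innerZl mulN1r. Qed.

Lemma innerBl N (u v w : 'cV[R]_N) : inner (u - v) w = inner u w - inner v w.
Proof. by rewrite innerDl innerNl. Qed.

Lemma innerDr N (u v w : 'cV[R]_N) : inner w (u + v) = inner w u + inner w v.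
Proof. by rewrite innerC innerDl !(innerC _ w). Qed.

Lemma innerZr N a (u v : 'cV[R]_N) : inner v (a *: u) = a * inner v u.
Proof. by rewrite innerC innerZl innerC. Qed.

Lemma innerNr N (u v : 'cV[R]_N) : inner v (- u) = - inner v u.
Proof. by rewrite innerC innerNl innerC. Qed.

Lemma innerBr N (u v w : 'cV[R]_N) : inner w (u - v) = inner w u - inner w v.
Proof. by rewrite innerDr innerNr. Qed.

Lemma inner0l N (u : 'cV[R]_N) : inner 0 u = 0.
Proof. by rewrite -(scale0r 0) innerZl mul0r. Qed.

Lemma inner0r N (u : 'cV[R]_N) : inner u 0 = 0.
Proof. by rewrite innerC inner0l. Qed.

Lemma inner_sumr N (I : finType) (F : I -> 'cV[R]_N) u :
  inner u (\sum_i F i) = \sum_i inner u (F i).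
Proof.
elim/big_rec2: _ => [|i a b _ IH]; first exact: inner0r.
by rewrite innerDr IH.
Qed.

Lemma inner_ge0 N (u : 'cV[R]_N) : 0 <= inner u u.
Proof. by apply: sumr_ge0 => i _; rewrite -expr2 sqr_ge0. Qed.

Lemma inner_eq0 N (u : 'cV[R]_N) : (inner u u == 0) = (u == 0).
Proof.
apply/eqP/eqP => [u0|->]; last exact: inner0l.
apply/colP => i; rewrite mxE; apply/eqP; rewrite -sqrf_eq0 expr2; apply/eqP.
by apply: (psumr_eq0P _ u0) => // j _; rewrite -expr2 sqr_ge0.
Qed.

Lemma inner_gt0 N (u : 'cV[R]_N) : (0 < inner u u) = (u != 0).
Proof. by rewrite lt0r inner_ge0 andbT inner_eq0. Qed.

Lemma inner_delta N (u : 'cV[R]_N) i : inner u (delta_mx i 0) = u i 0.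
Proof.
rewrite /inner (bigD1 i)//= big1 ?addr0 ?mxE ?eqxx ?mulr1// => j /negPf ji.
by rewrite mxE ji mulr0.
Qed.

Lemma inner_mulmxl N K (A : 'M[R]_(N, K)) u v :
  inner (A *m v) u = inner v (A^T *m u).
Proof. by rewrite !innerE trmx_mul mulmxA. Qed.

Lemma inner_mulmxr N K (A : 'M[R]_(N, K)) u v :
  inner u (A *m v) = inner (A^T *m u) v.
Proof. by rewrite innerC inner_mulmxl innerC. Qed.

Lemma inner_col_mx N K (u u' : 'cV[R]_N) (v v' : 'cV[R]_K) :
  inner (col_mx u v) (col_mx u' v') = inner u u' + inner v v'.
Proof. by rewrite !innerE tr_col_mx mul_row_col mxE. Qed.

Lemma inner_vsubmx N K (u v : 'cV[R]_(N + K)) :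
  inner u v = inner (usubmx u) (usubmx v) + inner (dsubmx u) (dsubmx v).
Proof. by rewrite -inner_col_mx !vsubmxK. Qed.

Lemma inner_submxcol n (p_ : 'I_n -> nat) (u v : 'cV[R]_(\sum_i p_ i)) :
  inner u v = \sum_i inner (submxcol u i) (submxcol v i).
Proof.
rewrite innerE -[u]submxcolK -[v]submxcolK tr_mxcol mul_mxrow_mxcol summxE.
by apply: eq_bigr => i _; rewrite !mxcolK innerE.
Qed.

Lemma enorm_sqr N (u : 'cV[R]_N) : enorm u ^+ 2 = inner u u.
Proof. by rewrite /enorm sqr_sqrtr// inner_ge0. Qed.

Lemma inner_sqrD N (u v : 'cV[R]_N) :
  inner (u + v) (u + v) = inner u u + 2 * inner u v + inner v v.
Proof. by rewrite !innerDl !innerDr (innerC v u); ring. Qed.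

Lemma inner_sqrB N (u v : 'cV[R]_N) :
  inner (u - v) (u - v) = inner u u - 2 * inner u v + inner v v.
Proof. by rewrite inner_sqrD !innerNl !innerNr opprK mulrN. Qed.

Lemma inner_sqrD_le N (u v : 'cV[R]_N) :
  inner (u + v) (u + v) <= 2 * inner u u + 2 * inner v v.
Proof. by have := inner_ge0 (u - v); rewrite inner_sqrB inner_sqrD; lra. Qed.

Lemma inner_young N c (u v : 'cV[R]_N) : 0 < c ->
  2 * inner u v <= c * inner u u + c^-1 * inner v v.
Proof.
move=> c0; have := inner_ge0 (c *: u - v).
rewrite inner_sqrB !innerZl !innerZr => expand_ge0.
by rewrite -(ler_pM2l c0) mulrDr mulVKf ?gt_eqF//; lra.
Qed.

Lemma inner_young_bounded N e (u v : 'cV[R]_N) : 0 <= e -> inner v v <= e ^+ 2 ->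
  2 * inner u v <= e * (inner u u + 1).
Proof.
rewrite le_eqVlt => /predU1P[<-|e0] ve.
  have /eqP : inner v v == 0 by rewrite eq_le inner_ge0 andbT (le_trans ve)// expr0n.
  by move=> /eqP; rewrite inner_eq0 => /eqP->; rewrite inner0r mulr0 mul0r.
apply: le_trans (inner_young u v e0) _; rewrite mulrDr mulr1 lerD2l.
by rewrite ler_pdivrMl// -expr2.
Qed.

Lemma inner_CauchySchwarz N (u v : 'cV[R]_N) :
  inner u v ^+ 2 <= inner u u * inner v v.
Proof.
have [->|v0] := eqVneq v 0; first by rewrite !inner0r expr0n mulr0.
have vv0 : 0 < inner v v by rewrite inner_gt0.
have := inner_ge0 (inner v v *: u - inner u v *: v).
rewrite inner_sqrB !innerZl !innerZr => expand_ge0.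
by rewrite -(ler_pM2l vv0); lra.
Qed.

Lemma normr_coord_le_enorm N (u : 'cV[R]_N) i : `|u i 0| <= enorm u.
Proof.
rewrite -sqrtr_sqr ler_wsqrtr// /inner (bigD1 i)//= expr2 lerDl.
by rewrite sumr_ge0// => j _; rewrite -expr2 sqr_ge0.
Qed.

(* If [A^T z = w], then [|w|^4 = <z, A w>^2 <= |z|^2 |A w|^2 <= c |z|^2 |w|^2]. *)
Lemma inner_trmx_le N K (A : 'M[R]_(N, K)) c : 0 <= c ->
  (forall w, inner (A *m w) (A *m w) <= c * inner w w) ->
  forall z, inner (A^T *m z) (A^T *m z) <= c * inner z z.
Proof.
move=> c0 Ac z; set w := A^T *m z.
have [->|w0] := eqVneq w 0; first by rewrite inner0l mulr_ge0 ?inner_ge0.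
have ww0 : 0 < inner w w by rewrite inner_gt0.
have wE : inner w w = inner z (A *m w) by rewrite inner_mulmxl trmxK.
rewrite -(ler_pM2r ww0) {1 2}wE -expr2; apply: le_trans (inner_CauchySchwarz _ _) _.
by rewrite mulrAC [leRHS]mulrC ler_wpM2l ?inner_ge0.
Qed.

Lemma mulmx_gram_eq0 N K (A : 'M[R]_(N, K)) (w : 'cV[R]_K) :
  A^T *m A *m w = 0 <-> A *m w = 0.
Proof.
split=> [Aw|Aw]; last by rewrite -mulmxA Aw mulmx0.
by apply/eqP; rewrite -inner_eq0 inner_mulmxl mulmxA Aw inner0r.
Qed.

End InnerProduct.

Section MatrixLimits.
Variables (R : realType) (T : Type) (F : set_system T).
Context {FF : Filter F}.

Lemma cvg_mxP N K (w : T -> 'M[R]_(N, K)) (l : 'M[R]_(N, K)) :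
  w @ F --> l <-> forall i j, w x i j @[x --> F] --> l i j.
Proof.
split=> [wl i j|wl].
  have coord_cvg := @coord_continuous R N K i j l.
  exact: (@cvg_comp _ _ _ w (fun M : 'M[R]_(N, K) => M i j) _ _ _ wl coord_cvg).
move=> A [P Pl PA].
have : \forall x \near F, forall i j, P i j (w x i j).
  by apply: filter_forall => i; apply: filter_forall => j; exact: wl (Pl i j).
by apply: filterS => x wP; exact: PA.
Qed.

Lemma cvg_coord N (w : T -> 'cV[R]_N) (l : 'cV[R]_N) i :
  w @ F --> l -> w x i 0 @[x --> F] --> l i 0.
Proof. by move/cvg_mxP; exact. Qed.

Lemma cvg_sumr (I : finType) (f : I -> T -> R) (l : I -> R) :
  (forall i, f i @ F --> l i) -> \sum_i f i x @[x --> F] --> \sum_i l i.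
Proof. by move=> fl; apply: cvg_big => //; exact: add_continuous. Qed.

Lemma cvg_inner N (u v : T -> 'cV[R]_N) (a b : 'cV[R]_N) :
  u @ F --> a -> v @ F --> b -> inner (u x) (v x) @[x --> F] --> inner a b.
Proof. by move=> ua vb; apply: cvg_sumr => i; apply: cvgM; exact: cvg_coord. Qed.

Lemma cvg_inner_sub0 N (w : T -> 'cV[R]_N) (l : 'cV[R]_N) :
  inner (w x - l) (w x - l) @[x --> F] --> 0 -> w @ F --> l.
Proof.
move=> wl; have : enorm (w x - l) @[x --> F] --> 0.
  by rewrite -sqrtr0; exact: continuous_cvg (@sqrt_continuous R 0) wl.
move=> /cvgrPdist_le enorm0; apply/cvg_mxP => i j; rewrite ord1.
apply/cvgrPdist_le => e /enorm0; apply: filterS => x.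
rewrite sub0r normrN (ger0_norm (sqrtr_ge0 _)) distrC; apply: le_trans.
by have := normr_coord_le_enorm (w x - l) i; rewrite !mxE.
Qed.

Lemma cvg_mulmx N K (A : 'M[R]_(N, K)) (u : T -> 'cV[R]_K) (a : 'cV[R]_K) :
  u @ F --> a -> A *m u x @[x --> F] --> A *m a.
Proof.
move=> ua; apply/cvg_mxP => i j; rewrite mxE ord1; under eq_fun do rewrite mxE.
by apply: cvg_sumr => k; apply: cvgMl_tmp; exact: cvg_coord.
Qed.

Lemma cvg_trmx N K (w : T -> 'M[R]_(N, K)) (l : 'M[R]_(N, K)) :
  w @ F --> l -> (w x)^T @[x --> F] --> l^T.
Proof.
move=> /cvg_mxP wl; apply/cvg_mxP => i j; rewrite mxE.
by under eq_fun do rewrite mxE; exact: wl.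
Qed.

Lemma cvg_submxcol n (p_ : 'I_n -> nat) (u : T -> 'cV[R]_(\sum_i p_ i))
    (a : 'cV[R]_(\sum_i p_ i)) i :
  u @ F --> a -> submxcol (u x) i @[x --> F] --> submxcol a i.
Proof.
move=> /cvg_mxP ua; apply/cvg_mxP => j k; rewrite mxE.
by under eq_fun do rewrite mxE; exact: ua.
Qed.

Lemma cvg_usubmx N K (u : T -> 'cV[R]_(N + K)) (a : 'cV[R]_(N + K)) :
  u @ F --> a -> usubmx (u x) @[x --> F] --> usubmx a.
Proof.
move=> /cvg_mxP ua; apply/cvg_mxP => j k; rewrite mxE.
by under eq_fun do rewrite mxE; exact: ua.
Qed.

Lemma cvg_dsubmx N K (u : T -> 'cV[R]_(N + K)) (a : 'cV[R]_(N + K)) :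
  u @ F --> a -> dsubmx (u x) @[x --> F] --> dsubmx a.
Proof.
move=> /cvg_mxP ua; apply/cvg_mxP => j k; rewrite mxE.
by under eq_fun do rewrite mxE; exact: ua.
Qed.

End MatrixLimits.

Section Subsequences.
Variable R : realType.

Lemma cvg_subseq (T : topologicalType) (u : nat -> T) (l : T) (f : nat -> nat) :
  increasing_seq f -> u @ \oo --> l -> (u \o f) @ \oo --> l.
Proof.
move=> /unstable.mono_leq_infl f_ge; apply: cvg_comp => A [n _ nA]; exists n => // k nk.
by apply: nA; exact: leq_trans nk (f_ge k).
Qed.

Lemma bolzano_weierstrass_fin (I : finType) (u : I -> nat -> R) :
  (forall i, bounded_fun (u i)) ->
  exists2 f, increasing_seq f & forall i, cvgn (u i \o f).
Proof.
move=> ub; suff [f f_incr uf] : exists2 f, increasing_seq f &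
    forall i, i \in enum I -> cvgn (u i \o f).
  by exists f => // i; apply: uf; rewrite mem_enum.
elim: (enum I) => [|i s [f f_incr uf]]; first by exists id.
have [|g g_incr ug] := bolzano_weierstrass (u_ := u i \o f).
  by case: (ub i) => M [Mreal uM]; exists M; split=> // x /uM uM' k _; exact: uM'.
exists (f \o g) => [m n|j]; first by rewrite [LHS]f_incr; exact: g_incr.
rewrite inE => /predU1P[->//|/uf/cvg_ex[l ul]].
by apply/cvg_ex; exists l; exact: cvg_subseq g_incr ul.
Qed.

Lemma bolzano_weierstrass_cV N (w : nat -> 'cV[R]_N) B :
  (forall k, enorm (w k) <= B) ->
  exists2 f, increasing_seq f & cvgn (w \o f).
Proof.
move=> wB; have [i|f f_incr wf] := @bolzano_weierstrass_fin _ (fun i k => w k i 0).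
  exists B; split=> [|x Bx k _]; first exact: num_real.
  by apply: le_trans (ltW Bx); apply: le_trans (normr_coord_le_enorm _ _) (wB k).
exists f => //; apply/cvg_ex; exists (\col_i limn (fun k => w (f k) i 0)).
by apply/cvg_mxP => i j; rewrite mxE ord1; exact: wf.
Qed.

End Subsequences.

Section QuadraticForms.
Variable R : realType.

Lemma cvg_sqnormA (T : Type) (F : set_system T) {FF : Filter F} N (A : 'M[R]_N)
    (w : T -> 'cV[R]_N) (l : 'cV[R]_N) :
  w @ F --> l -> sqnormA A (w x) @[x --> F] --> sqnormA A l.
Proof. by move=> wl; apply: cvg_inner => //; exact: cvg_mulmx. Qed.

Lemma sqnormAZ N (A : 'M[R]_N) c v : sqnormA A (c *: v) = c ^+ 2 * sqnormA A v.
Proof. by rewrite /sqnormA -scalemxAr innerZl innerZr mulrA. Qed.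

Lemma sqnormA0 N (A : 'M[R]_N) : sqnormA A 0 = 0.
Proof. exact: inner0l. Qed.

Lemma sqnormAB N (A : 'M[R]_N) v w : A^T = A ->
  sqnormA A (v - w) = sqnormA A v - 2 * inner w (A *m v) + sqnormA A w.
Proof.
move=> Asym; rewrite /sqnormA mulmxBr innerBl !innerBr (inner_mulmxr _ v w) Asym.
by rewrite (innerC (A *m v)); ring.
Qed.

Lemma unit_sphere_compact N :
  compact [set v : 'rV[R]_N | inner v^T v^T = 1].
Proof.
apply: bounded_closed_compact.
  exists 1; split=> [|x x1 v /= v1]; first exact: num_real.
  rewrite [leLHS]/Num.Def.normr/= mx_normrE; apply/bigmax_leP; split=> [|[i j] _ /=].
    exact: le_trans ler01 (ltW x1).
  apply: le_trans (ltW x1); have := normr_coord_le_enorm v^T j.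
  by rewrite /enorm v1 sqrtr1 mxE ord1.
apply: (@preimage_closed _ _ (fun v : 'rV[R]_N => inner v^T v^T) [set x | x = 1]);
  last exact: closed_eq.
by move=> v _; apply: (@cvg_inner _ _ (nbhs v)); apply: cvg_trmx; exact: cvg_id.
Qed.

Lemma sqnormA_sphere_max N (A : 'M[R]_N) (v : 'cV[R]_N) : v != 0 ->
  exists2 u, inner u u = 1 & forall w, sqnormA A w <= sqnormA A u * inner w w.
Proof.
have normalize (w : 'cV[R]_N) : w != 0 ->
    exists2 u, inner u u = 1 & w = enorm w *: u.
  rewrite -inner_gt0 => w0; exists ((enorm w)^-1 *: w).
    by rewrite innerZl innerZr mulrA -invfM -expr2 enorm_sqr mulVf ?gt_eqF.
  by rewrite scalerA divff ?scale1r// gt_eqF// sqrtr_gt0.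
move=> /normalize[v1 v11 _].
have sphere0 : [set u : 'rV[R]_N | inner u^T u^T = 1] !=set0.
  by exists v1^T; rewrite /= trmxK.
have [|u /set_mem u1 umax] := compact_EVT_max (f := fun u => sqnormA A u^T) sphere0
    (@unit_sphere_compact N).
  apply: continuous_subspaceT => u; apply: (@cvg_sqnormA _ (nbhs u)).
  by apply: cvg_trmx; exact: cvg_id.
exists u^T => // w; have [->|w0] := eqVneq w 0; first by rewrite sqnormA0 inner0l mulr0.
have [z z1 ->] := normalize _ w0.
rewrite sqnormAZ innerZl innerZr z1 mulr1 -expr2 mulrC ler_wpM2r ?sqr_ge0//.
by have := umax z^T; rewrite trmxK; apply; rewrite inE /= trmxK.
Qed.

Definition pos_def_mx N (A : 'M[R]_N) : Prop := forall v, v != 0 -> 0 < sqnormA A v.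

Lemma pos_def_mx_ge0 N (A : 'M[R]_N) v : pos_def_mx A -> 0 <= sqnormA A v.
Proof. by move=> A0; have [->|/A0/ltW//] := eqVneq v 0; rewrite sqnormA0. Qed.

Lemma pos_def_mx_coercive N (A : 'M[R]_N) : pos_def_mx A ->
  exists2 c, 0 < c & forall v, c * inner v v <= sqnormA A v.
Proof.
move=> A0; have [[v v0]|/forallNP no_vec] := pselect (exists v : 'cV[R]_N, v != 0).
  have [u u1 umin] := sqnormA_sphere_max (- A) v0.
  exists (sqnormA A u) => [|w]; first by apply: A0; rewrite -inner_gt0 u1.
  by have := umin w; rewrite /sqnormA !mulNmx !innerNr mulNr lerN2.
exists 1 => // v; have /negP/negPn/eqP-> := no_vec v.
by rewrite inner0l mulr0 sqnormA0.
Qed.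

(* The derivative at [t = 0] of [c |u - t d|^2 - |u - t d|_A^2] vanishes for
   every direction [d], in particular for [d = c u - A u]. *)
Lemma sqnormA_max_eigen N (A : 'M[R]_N) c (u : 'cV[R]_N) : A^T = A ->
  (forall w, sqnormA A w <= c * inner w w) -> sqnormA A u = c * inner u u ->
  A *m u = c *: u.
Proof.
move=> Asym Ac uc; set d := c *: u - A *m u.
suff /eqP : inner d d == 0 by move/eqP; rewrite inner_eq0 subr_eq0 eq_sym => /eqP.
rewrite eq_le inner_ge0 andbT; set K := c * inner d d - sqnormA A d.
apply/ler_addgt0Pr => e e0; rewrite add0r.
have K0 : 0 <= K by rewrite subr_ge0.
pose t := e / (K + 1); have K1 : 0 < K + 1 by lra.
have t0 : 0 < t by rewrite divr_gt0.
have tK : t * K <= e by rewrite mulrAC ler_pdivrMr// ler_pM2l//; lra.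
have du : inner d d = c * inner u d - inner d (A *m u).
  by rewrite {1}/d innerBl innerZl (innerC (A *m u)).
have := Ac (u - t *: d).
rewrite sqnormAB// inner_sqrB uc sqnormAZ !innerZl !innerZr => dt.
have : t * (2 * inner d d) <= t * (t * K) by rewrite du /K; lra.
by rewrite ler_pM2l//; have := inner_ge0 d; lra.
Qed.

Lemma rayleigh_le N (A : 'M[R]_N) (w : 'cV[R]_N) : A^T = A ->
  sqnormA A w <= lambda_max A * inner w w.
Proof.
move=> Asym; have [->|w0] := eqVneq w 0; first by rewrite sqnormA0 inner0l mulr0.
have [u u1 umax] := sqnormA_sphere_max A w0.
have Au : A *m u = sqnormA A u *: u by apply: sqnormA_max_eigen; rewrite ?u1 ?mulr1.
have u0 : u != 0 by rewrite -inner_gt0 u1.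
apply: le_trans (umax w) _; rewrite ler_wpM2r ?inner_ge0//.
apply: ub_le_sup; last first.
  apply/eigenvalueP; exists u^T; last by rewrite trmx_eq0.
  by rewrite -[X in _ *m X]Asym -trmx_mul Au linearZ.
exists (sqnormA A u) => a /eigenvalueP[v va v0].
have := umax v^T; rewrite /sqnormA -[A in A *m v^T]Asym -trmx_mul va linearZ/= innerZr.
by rewrite ler_pM2r// inner_gt0 trmx_eq0.
Qed.

End QuadraticForms.

Section RobbinsSiegmund.
Variable R : realType.
Variables s a b d : nat -> R.
Hypotheses (s0 : forall k, 0 <= s k) (a0 : forall k, 0 <= a k)
  (b0 : forall k, 0 <= b k) (d0 : forall k, 0 <= d k).
Hypotheses (sum_a : cvgn (series a)) (sum_b : cvgn (series b)).
Hypothesis s_step : forall k, s k.+1 <= (1 + a k) * s k + b k - d k.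

Let series_le_lim (u : nat -> R) n : (forall k, 0 <= u k) -> cvgn (series u) ->
  series u n <= limn (series u).
Proof.
by move=> u0 ?; apply: nondecreasing_cvgn_le => //; exact: nondecreasing_series.
Qed.

Lemma robbins_siegmund_bounded : exists2 B, 0 <= B & forall k, s k <= B.
Proof.
have sB k : s k <= expR (series a k) * (s 0%N + series b k).
  elim: k => [|k IHk]; first by rewrite /series/= !big_geq// expR0 mul1r addr0.
  rewrite !seriesS expRD addrCA mulrDr [leRHS]addrC.
  apply: le_trans (_ : _ <= (1 + a k) * s k + b k) _.
    by have := s_step k; have := d0 k; lra.
  apply: lerD.
    by rewrite -mulrA ler_pM// ?addr_ge0// expR_ge1Dx.
  rewrite -[leLHS]mul1r ler_wpM2r// -expRD -expR0 ler_expR addr_ge0//.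
  by rewrite sumr_ge0.
exists (expR (limn (series a)) * (s 0%N + limn (series b))) => [|k].
  rewrite mulr_ge0 ?expR_ge0// addr_ge0//.
  by apply: le_trans (series_le_lim 0 b0 sum_b); rewrite sumr_ge0.
apply: le_trans (sB k) _; apply: ler_pM; rewrite ?expR_ge0 ?ler_expR//.
- by rewrite addr_ge0// sumr_ge0.
- exact: series_le_lim.
- by rewrite lerD2l; exact: series_le_lim.
Qed.

Let s_step_summable : exists2 c : nat -> R, [/\ forall k, 0 <= c k & cvgn (series c)] &
  forall k, s k.+1 <= s k + c k - d k.
Proof.
have [B B0 sB] := robbins_siegmund_bounded.
exists (B *: a + b) => [|k].
  split=> [k|]; first by rewrite addr_ge0// mulr_ge0.
  by apply: is_cvg_seriesD => //; exact: is_cvg_seriesZ.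
apply: le_trans (s_step k) _; rewrite mulrDl mul1r lerD2r -addrA lerD2l lerD2r.
by rewrite mulrC ler_wpM2r.
Qed.

Lemma robbins_siegmund_cvg : cvgn s.
Proof.
have [c [c0 sum_c] sc] := s_step_summable.
have -> : s = (s - series c) + series c by rewrite subrK.
apply: is_cvgD => //; apply: nonincreasing_is_cvgn.
  apply/nonincreasing_seqP => n; rewrite !fctE seriesSr.
  by have := sc n; have := d0 n; lra.
exists (- limn (series c)) => _ [n _ <-]; rewrite !fctE.
by have := s0 n; have := series_le_lim n c0 sum_c; lra.
Qed.

Lemma robbins_siegmund_residual : d @ \oo --> 0.
Proof.
have [c [c0 sum_c] sc] := s_step_summable.
apply: cvg_series_cvg_0; apply: nondecreasing_is_cvgn; first exact: nondecreasing_series.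
exists (s 0%N + limn (series c)) => _ [n _ <-].
suff : series d n + s n <= s 0%N + series c n.
  by have := s0 n; have := series_le_lim n c0 sum_c; lra.
elim: n => [|n IHn]; first by rewrite /series/= !big_geq// add0r addr0.
by rewrite !seriesSr; have := sc n; lra.
Qed.

End RobbinsSiegmund.

Section PredictionCorrection.
Variables (R : realType) (N : nat) (H M Q : 'M[R]_N).
Hypothesis HM : H *m M = Q.

Local Notation D := (Q^T + Q - M^T *m H *m M).

Lemma sqnormA_prediction (e : 'cV[R]_N) :
  sqnormA D e = 2 * inner e (Q *m e) - sqnormA H (M *m e).
Proof.
rewrite /sqnormA mulmxBl mulmxDl innerBr innerDr -!mulmxA (mulmxA H) HM.
by rewrite (inner_mulmxr Q^T) (inner_mulmxr M^T) !trmxK (innerC (Q *m e)); ring.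
Qed.

Hypothesis Hsym : H^T = H.

Lemma sqnormA_correction (w e s : 'cV[R]_N) :
  sqnormA H (w - M *m e - s) =
  sqnormA H (w - s) - sqnormA D e - 2 * inner (w - e - s) (Q *m e).
Proof.
rewrite (addrAC w) (addrAC w (- e)); move: (w - s) => z.
rewrite sqnormAB// sqnormA_prediction inner_mulmxr Hsym mulmxA HM innerBl.
by rewrite (innerC (Q *m e)); ring.
Qed.

Lemma correction_descent (w wh v s : 'cV[R]_N) :
  0 <= inner (wh - s) (Q *m (w - wh) + v) ->
  sqnormA H (w - M *m (w - wh) - s) <=
  sqnormA H (w - s) - sqnormA D (w - wh) + 2 * inner (wh - s) v.
Proof. by rewrite innerDr sqnormA_correction subKr; lra. Qed.

End PredictionCorrection.

Section InexactFejer.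
Variables (R : realType) (N : nat) (H D : 'M[R]_N) (S : set 'cV[R]_N).
Variables (w wh v : nat -> 'cV[R]_N) (eta : nat -> R).
Hypotheses (H_pos : pos_def_mx H) (D_pos : pos_def_mx D).
Hypotheses (eta0 : forall k, 0 <= eta k) (sum_eta : cvgn (series eta)).
Hypothesis v_le_eta : forall k, inner (v k) (v k) <= eta k ^+ 2.
Hypothesis fejer : forall s, S s -> forall k, sqnormA H (w k.+1 - s) <=
  sqnormA H (w k - s) - sqnormA D (w k - wh k) + 2 * inner (wh k - s) (v k).

Let eta_bounded : exists2 E, 0 <= E & forall k, eta k <= E.
Proof.
have /bounded_fun_has_ubound[E etaE] := cvg_series_bounded sum_eta.
have {}etaE k : eta k <= E by apply: etaE; exists k.
by exists E => //; exact: le_trans (eta0 0) (etaE 0%N).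
Qed.

Let fejer_recursion s : S s -> exists a b d : R, [/\ 0 <= a, 0 <= b, 0 < d &
  forall k, sqnormA H (w k.+1 - s) <=
    (1 + a * eta k) * sqnormA H (w k - s) + b * eta k
    - d * inner (w k - wh k) (w k - wh k)].
Proof.
move=> Ss; have [cH cH0 hH] := pos_def_mx_coercive H_pos.
have [cD cD0 hD] := pos_def_mx_coercive D_pos; have [E E0 etaE] := eta_bounded.
have d0 : 0 < cD / 2 by rewrite divr_gt0.
have dV0 : 0 <= (cD / 2)^-1 by rewrite invr_ge0 ltW.
exists cH^-1, (1 + (cD / 2)^-1 * E), (cD / 2).
split=> // [||k]; first by rewrite invr_ge0 ltW.
  by rewrite addr_ge0// mulr_ge0.
have -> : (1 + cH^-1 * eta k) * sqnormA H (w k - s) = sqnormA H (w k - s) +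
    eta k * (cH^-1 * sqnormA H (w k - s)) by ring.
have iterate_term := inner_young_bounded (w k - s) (eta0 k) (v_le_eta k).
have prediction_term := inner_young (- (w k - wh k)) (v k) d0.
have v_split : inner (wh k - s) (v k) = inner (w k - s) (v k) - inner (w k - wh k) (v k).
  by rewrite -innerBl opprB [in RHS]addrC subrKA.
have v_small : (cD / 2)^-1 * inner (v k) (v k) <= (cD / 2)^-1 * E * eta k.
  rewrite -mulrA ler_wpM2l//; apply: le_trans (v_le_eta k) _.
  by rewrite expr2 ler_wpM2r.
have iterate_small : eta k * inner (w k - s) (w k - s) <=
    eta k * (cH^-1 * sqnormA H (w k - s)).
  by rewrite ler_wpM2l// ler_pdivlMl.
have := fejer Ss k; have := hD (w k - wh k).
rewrite v_split; rewrite !innerNl innerNr opprK in prediction_term.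
by lra.
Qed.

Lemma fejer_cvg s : S s -> cvgn (fun k => sqnormA H (w k - s)) /\
  inner (w k - wh k) (w k - wh k) @[k --> \oo] --> 0.
Proof.
move=> Ss; have [a [b [d [a0 b0 d0 w_step]]]] := fejer_recursion Ss.
have s0 k : 0 <= sqnormA H (w k - s) by exact: pos_def_mx_ge0.
have res0 k : 0 <= d * inner (w k - wh k) (w k - wh k).
  by rewrite mulr_ge0 ?inner_ge0 ?ltW.
have eta_sum c : 0 <= c -> (forall k, 0 <= c * eta k) /\ cvgn (series (fun k => c * eta k)).
  by move=> c0; split=> [k|]; [exact: mulr_ge0|exact: is_cvg_seriesZ].
have [a_eta0 sum_a] := eta_sum _ a0; have [b_eta0 sum_b] := eta_sum _ b0.
split; first exact: robbins_siegmund_cvg s0 a_eta0 b_eta0 res0 sum_a sum_b w_step.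
have residual := robbins_siegmund_residual s0 a_eta0 b_eta0 res0 sum_a sum_b w_step.
rewrite -(mulr0 d^-1); under eq_fun do rewrite -[inner _ _](mulKf (lt0r_neq0 d0)).
exact: cvgMl_tmp.
Qed.

Lemma fejer_bounded : S !=set0 -> exists B, forall k, enorm (w k) <= B.
Proof.
move=> [s Ss]; have [c c0 hH] := pos_def_mx_coercive H_pos.
have [/cvg_seq_bounded/bounded_fun_has_ubound[B sB] _] := fejer_cvg Ss.
exists (Num.sqrt (2 * (c^-1 * B) + 2 * inner s s)) => k; rewrite ler_wsqrtr//.
rewrite -{1 2}(subrK s (w k)); apply: le_trans (inner_sqrD_le _ _) _.
rewrite lerD2r ler_pM2l// -ler_pdivrMl ?invr_gt0// invrK.
by apply: le_trans (hH _) _; apply: sB; exists k.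
Qed.

Hypothesis cluster_mem : forall f l, increasing_seq f ->
  (w \o f) @ \oo --> l -> (wh \o f) @ \oo --> l -> S l.

(* A cluster point lies in [S], so the distance to it converges; its limit is
   read off along the subsequence. *)
Theorem fejer_cvg_mem : S !=set0 -> exists2 l, S l & w @ \oo --> l.
Proof.
move=> S0; have [B wB] := fejer_bounded S0.
have [f f_incr /cvg_ex[l wl]] := bolzano_weierstrass_cV wB.
have Sl : S l.
  apply: (cluster_mem f_incr wl); have [s Ss] := S0; have [_ residual] := fejer_cvg Ss.
  have whE : wh \o f = (w \o f) - ((fun k => w k - wh k) \o f).
    by apply/funext => k; rewrite !fctE/= subKr.
  rewrite whE -[l]subr0; apply: cvgB; first exact: wl.
  by apply: (cvg_subseq f_incr); apply: cvg_inner_sub0; under eq_fun do rewrite subr0.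
exists l => //; have [dist_cvg _] := fejer_cvg Sl.
have dist0 : sqnormA H (w k - l) @[k --> \oo] --> 0.
  have subseq_lim := cvg_subseq f_incr dist_cvg.
  have subseq0 : ((fun k => sqnormA H (w k - l)) \o f) @ \oo --> sqnormA H (l - l).
    by apply: cvg_sqnormA; apply: cvgB => //; exact: cvg_cst.
  rewrite -(sqnormA0 H) -(subrr l).
  by rewrite -(cvg_unique (@norm_hausdorff _ _) subseq_lim subseq0).
have [c c0 hH] := pos_def_mx_coercive H_pos; apply: cvg_inner_sub0.
apply: (@squeeze_cvgr _ _ _ _ (cst 0) (fun k => c^-1 * sqnormA H (w k - l))).
- by apply: nearW => k; rewrite inner_ge0/= ler_pdivlMl.
- exact: cvg_cst.
- by rewrite -(mulr0 c^-1); exact: cvgMl_tmp.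
Qed.

End InexactFejer.

Section ConvexFunctions.
Variables (R : realType) (N : nat).
Implicit Types (X Y : set 'cV[R]_N) (f g h : 'cV[R]_N -> R).

Definition affine_fun h := forall u v t,
  h (t *: u + (1 - t) *: v) = t * h u + (1 - t) * h v.

Lemma affine_convex_fun h : affine_fun h -> convex_fun h.
Proof. by move=> h_aff u v t _ _; rewrite h_aff. Qed.

Lemma affine_funZ c h : affine_fun h -> affine_fun (fun x => c * h x).
Proof. by move=> h_aff u v t; rewrite h_aff; ring. Qed.

Lemma affine_fun_sum (I : finType) (h : I -> 'cV[R]_N -> R) :
  (forall i, affine_fun (h i)) -> affine_fun (fun x => \sum_i h i x).
Proof.
move=> h_aff u v t; rewrite !mulr_sumr -big_split/=.
by apply: eq_bigr => i _; exact: h_aff.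
Qed.

Lemma convex_funD f g : convex_fun f -> convex_fun g -> convex_fun (fun x => f x + g x).
Proof.
by move=> f_cvx g_cvx u v t t0 t1; have := f_cvx u v t t0 t1; have := g_cvx u v t t0 t1; lra.
Qed.

Lemma convex_funZ c f : 0 <= c -> convex_fun f -> convex_fun (fun x => c * f x).
Proof.
move=> c0 f_cvx u v t t0 t1; apply: le_trans (ler_wpM2l c0 (f_cvx u v t t0 t1)) _.
by rewrite mulrDr !(mulrCA c).
Qed.

Lemma convex_fun_sum (I : finType) (f : I -> 'cV[R]_N -> R) :
  (forall i, convex_fun (f i)) -> convex_fun (fun x => \sum_i f i x).
Proof.
move=> f_cvx u v t t0 t1; rewrite !mulr_sumr -big_split/=.
by apply: ler_sum => i _; exact: f_cvx.
Qed.

Lemma convex_setI X Y : convex_set_cV X -> convex_set_cV Y -> convex_set_cV (X `&` Y).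
Proof.
by move=> Xc Yc u v t [Xu Yu] [Xv Yv] t0 t1; split; [exact: Xc|exact: Yc].
Qed.

Lemma convex_sublevel_set (J : Type) (g : J -> 'cV[R]_N -> R) :
  (forall j, convex_fun (g j)) -> convex_set_cV [set x | forall j, g j x <= 0].
Proof.
move=> g_cvx u v t gu gv t0 t1 j; apply: le_trans (g_cvx j u v t t0 t1) _.
have t10 : 0 <= 1 - t by rewrite subr_ge0.
by have := mulr_ge0_le0 t0 (gu j); have := mulr_ge0_le0 t10 (gv j); lra.
Qed.

Lemma convex_zero_set (J : Type) (h : J -> 'cV[R]_N -> R) :
  (forall j, affine_fun (h j)) -> convex_set_cV [set x | forall j, h j x = 0].
Proof. by move=> h_aff u v t hu hv _ _ j; rewrite h_aff hu hv !mulr0 addr0. Qed.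

End ConvexFunctions.

Section LagrangeMultipliers.
Variable R : realType.

(* The multiplier is any slope separating the points above the axis [b = 0]
   from those below it. *)
Lemma scalar_multiplier (S : set (R * R)) :
  (forall a b a' b', S (a, b) -> S (a', b') -> 0 < b -> b' < 0 -> 0 <= a' * b - a * b') ->
  (forall a, S (a, 0) -> 0 <= a) ->
  (exists a b, S (a, b) /\ 0 < b) -> (exists a b, S (a, b) /\ b < 0) ->
  exists mu, forall a b, S (a, b) -> 0 <= a + mu * b.
Proof.
move=> S_cross S_axis [a1 [b1 [Sab1 b1_gt0]]] [a2 [b2 [Sab2 b2_lt0]]].
pose T := [set t | exists a b, [/\ S (a, b), 0 < b & t = - a / b]].
have T_ub a b : S (a, b) -> b < 0 -> ubound T (- a / b).
  move=> Sab b0 _ [a' [b' [Sab' b'0 ->]]].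
  rewrite ler_ndivlMr// mulrAC ler_pdivlMr//.
  by have := S_cross _ _ _ _ Sab' Sab b'0 b0; lra.
have T0 : T !=set0 by exists (- a1 / b1), a1, b1.
exists (sup T) => a b Sab; have [b0|b0|b0] := ltgtP b 0.
- have : sup T <= - a / b by apply: ge_sup => //; exact: T_ub.
  by rewrite ler_ndivlMr//; lra.
- have : - a / b <= sup T.
    by apply: ub_le_sup; [exists (- a2 / b2); exact: T_ub|exists a, b].
  by rewrite ler_pdivrMr//; lra.
- by rewrite b0 mulr0 addr0 S_axis// -b0.
Qed.

Variable N : nat.
Implicit Types (X : set 'cV[R]_N) (f h : 'cV[R]_N -> R).

(* [b] and [b'] are the values of the constraint at [x] and [x']: it vanishes
   somewhere on the segment, where [f] is nonnegative by assumption. *)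
Lemma convex_fun_cross_ge0 f (x x' : 'cV[R]_N) (b b' : R) : convex_fun f ->
  0 < b -> b' < 0 ->
  (forall t, 0 <= t -> t <= 1 -> t * b + (1 - t) * b' = 0 ->
     0 <= f (t *: x + (1 - t) *: x')) ->
  0 <= f x' * b - f x * b'.
Proof.
move=> f_cvx b0 b'0 f_seg.
pose w := b - b'; have w0 : 0 < w by rewrite /w; lra.
pose t := - b' / w; have tw : t * w = - b' by rewrite /t divfK// gt_eqF.
have t0 : 0 <= t by rewrite divr_ge0//; lra.
have t1 : t <= 1 by rewrite ler_pdivrMr// /w; lra.
have : 0 <= t * f x + (1 - t) * f x'.
  by apply: le_trans (f_cvx x x' t t0 t1); apply: f_seg => //; move: tw; rewrite /w; lra.
move=> /(mulr_ge0 (ltW w0)).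
have -> : w * (t * f x + (1 - t) * f x') = t * w * f x + (w - t * w) * f x' by ring.
by rewrite tw /w; lra.
Qed.

(* Adjoining the point [(0, 1)] to the image of [(f, h)] forces the slope to be
   nonnegative. *)
Lemma inequality_multiplier f h X xb :
  convex_set_cV X -> convex_fun f -> convex_fun h -> X xb -> h xb < 0 ->
  (forall x, X x -> h x <= 0 -> 0 <= f x) ->
  exists2 nu, 0 <= nu & forall x, X x -> 0 <= f x + nu * h x.
Proof.
move=> Xc f_cvx h_cvx Xxb hxb f_ge0.
pose S := [set p : R * R | (exists2 x, X x & p = (f x, h x)) \/ p = (0, 1)].
have [||||nu nuS] := @scalar_multiplier S; last 1 first.
- exists nu; first by have := nuS 0 1 (or_intror erefl); lra.
  by move=> x Xx; apply: nuS; left; exists x.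
- move=> a b a' b' [[x Xx [-> ->]]|[-> ->]] [[x' Xx' [-> ->]]|[-> ->]].
  + move=> hx hx'; apply: convex_fun_cross_ge0 => // t t0 t1 ht.
    by apply: f_ge0; [exact: Xc|rewrite -ht; exact: h_cvx].
  + by move=> _; rewrite ltr10.
  + by move=> _ h0; rewrite mulr1 mul0r subr0; apply: f_ge0 => //; exact: ltW.
  + by rewrite ltr10.
- move=> a [[x Xx [-> h0]]|[_ /eqP]]; first by apply: f_ge0; rewrite -?h0.
  by rewrite eq_sym oner_eq0.
- by exists 0, 1; split; [right|].
- by exists (f xb), (h xb); split => //; left; exists xb.
Qed.

Definition extends_beyond X (xb : 'cV[R]_N) :=
  forall x, X x -> exists2 e, 0 < e & X ((- e) *: x + (1 + e) *: xb).

Lemma equality_multiplier f h X xb :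
  convex_set_cV X -> convex_fun f -> affine_fun h -> X xb -> h xb = 0 ->
  extends_beyond X xb -> (forall x, X x -> h x = 0 -> 0 <= f x) ->
  exists mu, forall x, X x -> 0 <= f x + mu * h x.
Proof.
move=> Xc f_cvx h_aff Xxb hxb Xext f_ge0.
have [hX|/existsNP[x /not_implyP[Xx /eqP hx]]] := pselect (forall x, X x -> h x = 0).
  by exists 0 => x Xx; rewrite mul0r addr0 f_ge0// hX.
have [e e0 Xx'] := Xext _ Xx; set x' := _ + _ in Xx'.
have hx' : h x' = - e * h x.
  by have := h_aff x xb (- e); rewrite opprK -/x' => ->; rewrite hxb mulr0 addr0.
pose S := [set p : R * R | exists2 x, X x & p = (f x, h x)].
have two_sides : (exists a b, S (a, b) /\ 0 < b) /\ (exists a b, S (a, b) /\ b < 0).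
  have Sx : S (f x, h x) by exists x.
  have Sx' : S (f x', h x') by exists x'.
  have [hx0|hx0|] := ltgtP (h x) 0; last by move/eqP; rewrite (negPf hx).
    by split; [exists (f x'), (h x')|exists (f x), (h x)]; split=> //; rewrite hx'; nra.
  by split; [exists (f x), (h x)|exists (f x'), (h x')]; split=> //; rewrite hx'; nra.
have [||||mu muS] := @scalar_multiplier S; last 1 first.
- by exists mu => z Xz; apply: muS; exists z.
- move=> a b a' b' [u Xu [-> ->]] [u' Xu' [-> ->]] hu hu'.
  apply: convex_fun_cross_ge0 => // t t0 t1 ht.
  by apply: f_ge0; [exact: Xc|rewrite h_aff].
- by move=> a [u Xu [-> hu]]; apply: f_ge0.
- by case: two_sides.
- by case: two_sides.
Qed.

Definition ord_cons q (a : R) (b : 'I_q -> R) (j : 'I_q.+1) : R :=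
  if unlift ord0 j is Some k then b k else a.

Lemma sum_ord_cons q (a : R) (b : 'I_q -> R) (c : 'I_q.+1 -> R) :
  \sum_j ord_cons a b j * c j = a * c ord0 + \sum_j b j * c (lift ord0 j).
Proof.
rewrite big_ord_recl /ord_cons unlift_none; congr (_ + _).
by apply: eq_bigr => j _; rewrite liftK.
Qed.

Lemma forall_ord_recl q (A : 'I_q.+1 -> Prop) :
  A ord0 -> (forall j, A (lift ord0 j)) -> forall j, A j.
Proof. by move=> A0 AS j; case: (unliftP ord0 j) => [k|] ->. Qed.

Lemma inequality_multipliers q (g : 'I_q -> 'cV[R]_N -> R) f X xb :
  convex_set_cV X -> convex_fun f -> (forall j, convex_fun (g j)) ->
  X xb -> (forall j, g j xb < 0) ->
  (forall x, X x -> (forall j, g j x <= 0) -> 0 <= f x) ->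
  exists2 nu : 'I_q -> R, forall j, 0 <= nu j &
    forall x, X x -> 0 <= f x + \sum_j nu j * g j x.
Proof.
move=> Xc + + Xxb; elim: q g f => [|q IHq] g f f_cvx g_cvx gxb f_ge0.
  exists (fun=> 0) => [[]//|x Xx].
  by rewrite big_ord0 addr0 f_ge0// => -[].
pose X' := X `&` [set x | forall j, g (lift ord0 j) x <= 0].
have X'c : convex_set_cV X' by apply: convex_setI => //; exact: convex_sublevel_set.
have X'xb : X' xb by split=> // j; exact: ltW.
have [|nu0 nu0_ge0 f0] := inequality_multiplier X'c f_cvx (g_cvx ord0) X'xb (gxb ord0).
  by move=> x [Xx gx] gx0; apply: f_ge0 => //; exact: forall_ord_recl.
have [||||nu nu_ge0 fnu] :=
    IHq (fun j => g (lift ord0 j)) (fun x => f x + nu0 * g ord0 x) => //.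
- by apply: convex_funD => //; exact: convex_funZ.
- by move=> x Xx gx; exact: f0.
exists (ord_cons nu0 nu) => [j|x Xx]; last by rewrite sum_ord_cons addrA; exact: fnu.
by rewrite /ord_cons; case: unliftP.
Qed.

Lemma equality_multipliers p (h : 'I_p -> 'cV[R]_N -> R) f X xb :
  convex_set_cV X -> convex_fun f -> (forall j, affine_fun (h j)) ->
  X xb -> (forall j, h j xb = 0) -> extends_beyond X xb ->
  (forall x, X x -> (forall j, h j x = 0) -> 0 <= f x) ->
  exists mu : 'I_p -> R, forall x, X x -> 0 <= f x + \sum_j mu j * h j x.
Proof.
move=> Xc + + Xxb + Xext; elim: p h f => [|p IHp] h f f_cvx h_aff hxb f_ge0.
  by exists (fun=> 0) => x Xx; rewrite big_ord0 addr0 f_ge0// => -[].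
pose X' := X `&` [set x | forall j, h (lift ord0 j) x = 0].
have X'c : convex_set_cV X' by apply: convex_setI => //; exact: convex_zero_set.
have X'xb : X' xb by split=> // j; exact: hxb.
have X'ext : extends_beyond X' xb.
  move=> x [Xx hx]; have [e e0 Xe] := Xext _ Xx; exists e => //; split=> // j.
  by have := h_aff (lift ord0 j) x xb (- e); rewrite opprK => ->; rewrite hx hxb !mulr0 addr0.
have [|mu0 f0] := equality_multiplier X'c f_cvx (h_aff ord0) X'xb (hxb ord0) X'ext.
  by move=> x [Xx hx] hx0; apply: f_ge0 => //; exact: forall_ord_recl.
have [||||mu fmu] :=
    IHp (fun j => h (lift ord0 j)) (fun x => f x + mu0 * h ord0 x) => //.
- by apply: convex_funD => //; apply: affine_convex_fun; exact: affine_funZ.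
- by move=> x Xx hx; exact: f0.
by exists (ord_cons mu0 mu) => x Xx; rewrite sum_ord_cons addrA; exact: fmu.
Qed.

Theorem lagrange_multipliers p q (h : 'I_p -> 'cV[R]_N -> R)
    (g : 'I_q -> 'cV[R]_N -> R) f X xb :
  convex_set_cV X -> convex_fun f -> (forall j, affine_fun (h j)) ->
  (forall j, convex_fun (g j)) -> X xb -> (forall j, h j xb = 0) ->
  (forall j, g j xb < 0) -> extends_beyond X xb ->
  (forall x, X x -> (forall j, h j x = 0) -> (forall j, g j x <= 0) -> 0 <= f x) ->
  exists (mu : 'I_p -> R) (nu : 'I_q -> R), (forall j, 0 <= nu j) /\
    forall x, X x -> 0 <= f x + \sum_j mu j * h j x + \sum_j nu j * g j x.
Proof.
move=> Xc f_cvx h_aff g_cvx Xxb hxb gxb Xext f_ge0.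
pose X' := X `&` [set x | forall j, h j x = 0].
have X'c : convex_set_cV X' by apply: convex_setI => //; exact: convex_zero_set.
have X'xb : X' xb by split=> // j; exact: hxb.
have [|nu nu_ge0 fnu] := inequality_multipliers X'c f_cvx g_cvx X'xb gxb.
  by move=> x [Xx hx] gx; exact: f_ge0.
have f'_cvx : convex_fun (fun x => f x + \sum_j nu j * g j x).
  by apply: convex_funD => //; apply: convex_fun_sum => j; exact: convex_funZ.
have [|mu fmu] := equality_multipliers Xc f'_cvx h_aff Xxb hxb Xext.
  by move=> x Xx hx; exact: fnu.
by exists mu, nu; split=> // x Xx; rewrite addrAC; exact: fmu.
Qed.

End LagrangeMultipliers.

Lemma interior_extends_beyond (R : realType) N (X : set 'cV[R]_N) (xb x : 'cV[R]_N) :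
  X^° xb -> \forall e \near 0^'+, X ((- e) *: x + (1 + e) *: xb).
Proof.
move=> Xxb; have beyondE e : (- e) *: x + (1 + e) *: xb = xb + e *: (xb - x).
  by rewrite scaleNr scalerDl scale1r scalerBr addrCA (addrC (- _)).
under eq_near do rewrite beyondE.
have beyond_cvg : xb + e *: (xb - x) @[e --> 0^'+] --> xb.
  rewrite -[X in _ --> X]addr0; apply: cvgD; first exact: cvg_cst.
  rewrite -[X in _ --> X](scale0r (xb - x)); apply: cvgZr_tmp.
  exact: cvg_at_right_filter cvg_id.
exact: beyond_cvg Xxb.
Qed.

Lemma col_mulmx (R : pzSemiRingType) m n p (A : 'M[R]_(m, n)) (B : 'M[R]_(n, p)) j :
  col j (A *m B) = A *m col j B.
Proof. by apply/colP => i; rewrite !mxE; apply: eq_bigr => k _; rewrite mxE. Qed.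

Lemma submxcolZ (R : pzRingType) n (p_ : 'I_n -> nat) a (u : 'cV[R]_(\sum_i p_ i)) i :
  submxcol (a *: u) i = a *: submxcol u i.
Proof. by apply/colP => j; rewrite !mxE. Qed.

Section KroneckerIdentity.
Variables (R : pzRingType) (d : nat).
Implicit Types n k l : nat.

Local Notation blocks n := (\sum_(i < n) d)%N.
Local Notation block Y i := (@submxcol R _ (fun=> d) 1 Y i).

Definition unstack n (Y : 'cV[R]_(blocks n)) : 'M[R]_(n, d) :=
  \matrix_(i, c) block Y i c 0.

Definition stack_rows n (A : 'M[R]_(n, d)) : 'cV[R]_(blocks n) :=
  @mxcol R n (fun=> d) 1 (fun i => (row i A)^T).

Lemma stack_rowsK n : cancel (@stack_rows n) (@unstack n).
Proof. by move=> A; apply/matrixP => i c; rewrite mxE mxcolK !mxE. Qed.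

Lemma unstackK n : cancel (@unstack n) (@stack_rows n).
Proof.
move=> Y; apply/(@mxcolP _ n (fun=> d)) => i; rewrite mxcolK.
by apply/matrixP => c j; rewrite !mxE ord1.
Qed.

Lemma unstack_inj n : injective (@unstack n).
Proof. exact: can_inj (@unstackK n). Qed.

Lemma unstack0 n : unstack (0 : 'cV[R]_(blocks n)) = 0.
Proof. by apply/matrixP => i c; rewrite !mxE. Qed.

Definition kron_id n k (A : 'M[R]_(n, k)) : 'M[R]_(blocks n, blocks k) :=
  @mxblock R n k (fun=> d) (fun=> d) (fun i j => (A i j)%:M).

Lemma submxcol_kron_id n k (A : 'M[R]_(n, k)) Y i :
  block (kron_id A *m Y) i = \sum_j A i j *: block Y j.
Proof.
rewrite -[Y in LHS](@submxcolK _ k (fun=> d)) /kron_id mul_mxblock_mxrow mxcolK.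
by apply: eq_bigr => j _; rewrite mul_scalar_mx.
Qed.

Lemma unstack_kron_id n k (A : 'M[R]_(n, k)) Y :
  unstack (kron_id A *m Y) = A *m unstack Y.
Proof.
apply/matrixP => i c; rewrite mxE submxcol_kron_id summxE mxE.
by apply: eq_bigr => j _; rewrite !mxE.
Qed.

Lemma kron_id_mulA n k l (A : 'M[R]_(n, k)) (B : 'M[R]_(k, l))
    (Y : 'cV[R]_(blocks l)) :
  kron_id (A *m B) *m Y = kron_id A *m (kron_id B *m Y).
Proof. by apply: unstack_inj; rewrite !unstack_kron_id mulmxA. Qed.

Lemma tr_kron_id n k (A : 'M[R]_(n, k)) : (kron_id A)^T = kron_id A^T.
Proof. by rewrite /kron_id tr_mxblock; apply: eq_mxblock => i j; rewrite tr_scalar_mx mxE. Qed.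

End KroneckerIdentity.
Arguments kron_id {R d n k}.

Section KroneckerInner.
Variables (R : realType) (d : nat).

Lemma inner_unstack n (Y W : 'cV[R]_(\sum_(i < n) d)) :
  inner Y W = \sum_c inner (col c (unstack Y)) (col c (unstack W)).
Proof.
rewrite (inner_submxcol (p_ := fun=> d)) /inner exchange_big/=.
by apply: eq_bigr => c _; apply: eq_bigr => i _; rewrite !mxE.
Qed.

Lemma inner_kron_id_le n k (A : 'M[R]_(n, k)) c :
  (forall w, inner (A *m w) (A *m w) <= c * inner w w) ->
  forall Y : 'cV[R]_(\sum_(j < k) d),
  inner (kron_id A *m Y) (kron_id A *m Y) <= c * inner Y Y.
Proof.
move=> Ac Y; rewrite !inner_unstack unstack_kron_id mulr_sumr; apply: ler_sum => j _.
by rewrite col_mulmx.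
Qed.

End KroneckerInner.

Lemma submx_of_kernel (F : fieldType) m n p (A : 'M[F]_(m, n)) (B : 'M[F]_(p, n)) :
  (forall w : 'cV_n, B *m w = 0 -> A *m w = 0) -> (A <= B)%MS.
Proof.
move=> kerBA; rewrite submxE; apply/eqP/matrixP => i j.
have /colP/(_ i) : col j (A *m cokermx B) = 0.
  by rewrite col_mulmx kerBA// -col_mulmx mulmx_coker raddf0.
by rewrite !mxE.
Qed.

Section BlockDiagonal.
Variables (R : fieldType) (n : nat) (p_ : 'I_n -> nat).
Implicit Types a b : 'I_n -> R.

Definition mxdiag_scalar a : 'M[R]_(\sum_i p_ i) := \mxdiag_i (a i)%:M.

Lemma mxdiag_scalarM a b :
  mxdiag_scalar a *m mxdiag_scalar b = mxdiag_scalar (fun i => a i * b i).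
Proof.
rewrite /mxdiag_scalar [X in _ *m X]/mxdiag mul_mxdiag_mxblock /mxdiag.
apply: eq_mxblock => i j; case: eqVneq => [<-|_]; last by rewrite mulmx0.
by rewrite !conform_mx_id -scalar_mxM.
Qed.

Lemma tr_mxdiag_scalar a : (mxdiag_scalar a)^T = mxdiag_scalar a.
Proof.
by rewrite /mxdiag_scalar tr_mxdiag; apply: eq_mxdiag => i; rewrite tr_scalar_mx.
Qed.

Lemma mulmx_mxdiag_scalarV a : (forall i, a i != 0) ->
  mxdiag_scalar a *m mxdiag_scalar (fun i => (a i)^-1) = 1%:M.
Proof.
move=> a0; rewrite mxdiag_scalarM -mxdiagZ; apply: eq_mxdiag => i.
by rewrite divff.
Qed.

Lemma mxdiag_scalar_unit a : (forall i, a i != 0) -> mxdiag_scalar a \in unitmx.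
Proof. by move=> /mulmx_mxdiag_scalarV/mulmx1_unit[]. Qed.

Lemma invmx_mxdiag_scalar a : (forall i, a i != 0) ->
  invmx (mxdiag_scalar a) = mxdiag_scalar (fun i => (a i)^-1).
Proof.
move=> a0; rewrite -[RHS](mulKmx (mxdiag_scalar_unit a0)).
by rewrite mulmx_mxdiag_scalarV// mulmx1.
Qed.

Lemma submxcol_mxdiag_scalar a (u : 'cV[R]_(\sum_i p_ i)) i :
  submxcol (mxdiag_scalar a *m u) i = a i *: submxcol u i.
Proof. by rewrite -[u in LHS]submxcolK mul_mxdiag_mxcol mxcolK mul_scalar_mx. Qed.

End BlockDiagonal.

Section BlockDiagonalForms.
Variables (R : realType) (n : nat) (p_ : 'I_n -> nat) (a : 'I_n -> R).
Implicit Types u v : 'cV[R]_(\sum_i p_ i).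

Lemma inner_mxdiag_scalar u v :
  inner u (mxdiag_scalar p_ a *m v) = \sum_i a i * inner (submxcol u i) (submxcol v i).
Proof.
by rewrite inner_submxcol; apply: eq_bigr => i _; rewrite submxcol_mxdiag_scalar innerZr.
Qed.

Lemma pos_def_mxdiag_scalar : (forall i, 0 < a i) -> pos_def_mx (mxdiag_scalar p_ a).
Proof.
move=> a0 u u0; rewrite /sqnormA inner_mxdiag_scalar.
have term_ge0 i : 0 <= a i * inner (submxcol u i) (submxcol u i).
  by rewrite mulr_ge0 ?inner_ge0 ?ltW.
rewrite lt0r sumr_ge0// andbT; apply: contraNneq u0 => sum0.
apply/eqP/mxcolP => i; apply/eqP; rewrite submxcol0 -inner_eq0.
have /eqP := psumr_eq0P (fun j _ => term_ge0 j) sum0 (i := i) isT.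
by rewrite mulf_eq0 gt_eqF.
Qed.

End BlockDiagonalForms.

Definition convex_problem (R : realType) (P : Problem R) : Prop :=
  [/\ forall i, convex_fun (pf P i),
      forall i j, convex_fun (fun u => pg P i u j 0) &
      forall i, convex_set_cV (pOmega P i)].

Section Lagrangian.
Variables (R : realType) (P : Problem R).
Local Notation m := (pm P).
Local Notation d := (pp P + pq P)%N.
Implicit Types (x : 'cV[R]_(nx P)) (Y : 'cV[R]_(ny P)) (y : 'cV[R]_d).

Lemma xblk_comb x x' a b i : xblk (a *: x + b *: x') i = a *: xblk x i + b *: xblk x' i.
Proof. by rewrite /xblk submxcolD !submxcolZ. Qed.

Lemma yblkB Y Y' i : yblk (Y - Y') i = yblk Y i - yblk Y' i.
Proof. exact: submxcolB. Qed.

Lemma yblkP Y Y' : (forall i, yblk Y i = yblk Y' i) -> Y = Y'.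
Proof. by move=> eqY; apply/(@mxcolP _ m (fun=> d)). Qed.

Lemma yblk_ones_kron y i : yblk (ones_kron y : 'cV[R]_(ny P)) i = y.
Proof. exact: mxcolK. Qed.

Definition in_Omega x := forall i, pOmega P i (xblk x i).
Definition in_Kpolar Y := forall i, Kpolar (yblk Y i).

Lemma in_Kpolar_ones_kron y : Kpolar y -> in_Kpolar (ones_kron y).
Proof. by move=> Ky i; rewrite yblk_ones_kron. Qed.

Definition lagrangian x Y : R :=
  \sum_i (pf P i (xblk x i) + inner (yblk Y i) (Gi (xblk x i))).

Lemma lagrangian_ones_kron x y :
  lagrangian x (ones_kron y) = Fobj x + inner y (\sum_i Gi (xblk x i)).
Proof.
rewrite inner_sumr -big_split/=.
by apply: eq_bigr => i _; rewrite yblk_ones_kron.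
Qed.

Lemma ell_fin i (xi : 'cV[R]_(pn P i)) y : pOmega P i xi -> Kpolar y ->
  ell xi y = (pf P i xi + inner y (Gi xi))%:E.
Proof. by move=> Ox Ky; rewrite /ell /Defs.indic (asboolT Ox) (asboolT Ky) oppe0 !adde0. Qed.

Lemma ell_Ny i (xi : 'cV[R]_(pn P i)) y : ~ Kpolar y -> ell xi y = -oo%E.
Proof. by move=> Ky; rewrite /ell /Defs.indic (asboolF Ky) addeNy. Qed.

Lemma ell_y i (xi : 'cV[R]_(pn P i)) y : ~ pOmega P i xi -> Kpolar y -> ell xi y = +oo%E.
Proof. by move=> Ox Ky; rewrite /ell /Defs.indic (asboolF Ox) (asboolT Ky) oppe0 adde0. Qed.

Lemma Lag_fin x Y : in_Omega x -> in_Kpolar Y -> Lag x Y = (lagrangian x Y)%:E.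
Proof.
by move=> Ox KY; rewrite /Lag; under eq_bigr do rewrite ell_fin//; rewrite sumEFin.
Qed.

Lemma Lag_Ny x Y : ~ in_Kpolar Y -> Lag x Y = -oo%E.
Proof.
by move=> /existsNP[i KY]; apply/esum_eqNyP; exists i; split=> //; exact: ell_Ny.
Qed.

Lemma Lag_y x Y : ~ in_Omega x -> in_Kpolar Y -> Lag x Y = +oo%E.
Proof.
move=> /existsNP[i Ox] KY; apply/esum_eqyP; last by exists i; split=> //; exact: ell_y.
move=> j _; have [Oj|Oj] := pselect (pOmega P j (xblk x j)); first by rewrite ell_fin.
by rewrite ell_y.
Qed.

Lemma Lag_fin_num x Y : Lag x Y \is a fin_num -> in_Omega x /\ in_Kpolar Y.
Proof.
have [KY|KY] := pselect (in_Kpolar Y); last by rewrite Lag_Ny.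
by have [Ox|Ox] := pselect (in_Omega x); [|rewrite Lag_y].
Qed.

Definition saddle_point r (U : 'M[R]_(r, m)) x Y (Z : 'cV[R]_(nz P r)) : Prop :=
  [/\ in_Omega x, in_Kpolar Y, Ubold U *m Y = 0 &
      forall x' Y', in_Omega x' -> in_Kpolar Y' ->
      lagrangian x Y' <= lagrangian x' Y + inner (Ubold U *m Y') Z].

Lemma Phi_zerosP r (U : 'M[R]_(r, m)) xi : Phi_zeros U xi <->
  saddle_point U (usubmx xi) (usubmx (dsubmx xi)) (dsubmx (dsubmx xi)).
Proof.
rewrite /Phi_zeros /=; set x := usubmx xi; set Y := usubmx _; set Z := dsubmx _.
split=> [[a [b [c [abc0 [Lfin Lx] [_ [w [_ LY] <-] bw] cU]]]]|[Ox KY UY saddle]].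
  have [a0 /(eq_col_mx (B1 := 0))] : a = 0 /\ col_mx b c = col_mx 0 0.
    by apply: eq_col_mx; rewrite -abc0 !col_mx0.
  move=> [b0 c0]; have wE : w = - ((Ubold U)^T *m Z).
    by apply/eqP; rewrite -addr_eq0 -[w]opprK -bw b0.
  have UY : Ubold U *m Y = 0 by apply/eqP; rewrite -oppr_eq0 -cU c0.
  have [Ox KY] := Lag_fin_num Lfin; split=> // x' Y' Ox' KY'.
  have := Lx x'; have := LY Y'.
  rewrite a0 inner0l adde0 !Lag_fin// wE innerNl inner_mulmxl trmxK mulmxBr UY subr0.
  by rewrite innerC -!EFinN -!EFinD !lee_fin; lra.
exists 0, 0, 0; split; first by rewrite !col_mx0.
- split=> [|x']; first by rewrite Lag_fin.
  rewrite inner0l adde0; have [Ox'|Ox'] := pselect (in_Omega x'); last first.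
    by rewrite (Lag_y Ox')// leey.
  by rewrite !Lag_fin// lee_fin; have := saddle x' Y Ox' KY; rewrite UY inner0l addr0.
- exists ((Ubold U)^T *m Z); last by rewrite addNr.
  exists (- ((Ubold U)^T *m Z)); last by rewrite opprK.
  split=> [|Y']; first by rewrite Lag_fin// -EFinN.
  have [KY'|KY'] := pselect (in_Kpolar Y'); last by rewrite (Lag_Ny _ KY') /= leey.
  rewrite !Lag_fin// -!EFinN -EFinD lee_fin innerNl inner_mulmxl trmxK mulmxBr UY subr0.
  by rewrite innerC; have := saddle x Y' Ox KY'; lra.
- by rewrite UY oppr0.
Qed.

End Lagrangian.

Definition kernel_ones (R : pzRingType) n r (U : 'M[R]_(r, n)) : Prop :=
  forall w : 'cV[R]_n, U *m w = 0 <-> exists c, w = c *: const_mx 1.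

Section Consensus.
Variables (R : realType) (P : Problem R) (r : nat) (U : 'M[R]_(r, pm P)).
Local Notation d := (pp P + pq P)%N.
Hypothesis kerU : kernel_ones U.

Lemma Ubold_ones_kron (y : 'cV[R]_d) : Ubold U *m ones_kron y = 0.
Proof.
apply: unstack_inj; rewrite unstack_kron_id unstack0.
have -> : unstack (ones_kron y : 'cV[R]_(ny P)) = const_mx 1 *m y^T.
  apply/matrixP => i c; rewrite mxE -/(yblk _ _) yblk_ones_kron mxE big_ord1.
  by rewrite !mxE mul1r.
have U1 : U *m const_mx 1 = 0 :> 'cV_r by apply/kerU; exists 1; rewrite scale1r.
by rewrite mulmxA U1 mul0mx.
Qed.

Lemma Ubold_ker Y : Ubold U *m Y = 0 -> exists y : 'cV[R]_d, Y = ones_kron y.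
Proof.
move=> /(congr1 (@unstack _ _ _)); rewrite unstack_kron_id unstack0 => UY.
have /fin_all_exists[y yE] c : exists a : R, col c (unstack Y) = a *: const_mx 1.
  by apply/kerU; rewrite -col_mulmx UY raddf0.
exists (\col_c y c); apply: yblkP => i; rewrite yblk_ones_kron; apply/colP => c.
by have /colP/(_ i) := yE c; rewrite !mxE mulr1 => <-.
Qed.

Lemma trUbold_range W : \sum_i yblk W i = 0 -> exists Z, (Ubold U)^T *m Z = W.
Proof.
move=> W0; have /submxP[D WD] : ((unstack W)^T <= U)%MS.
  apply: submx_of_kernel => w /kerU[a ->]; rewrite -scalemxAr.
  suff -> : (unstack W)^T *m const_mx 1 = \sum_i yblk W i by rewrite W0 scaler0.
  apply/colP => c; rewrite mxE summxE; apply: eq_bigr => i _.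
  by rewrite !mxE mulr1.
exists (stack_rows D^T); apply: unstack_inj.
by rewrite [(Ubold U)^T]tr_kron_id unstack_kron_id stack_rowsK -trmx_mul -WD trmxK.
Qed.

End Consensus.

Lemma trUbold_inj (R : realType) (P : Problem R) r (U : 'M[R]_(r, pm P)) :
  row_free U -> injective (mulmx (Ubold U)^T : 'cV_(nz P r) -> 'cV_(ny P)).
Proof.
move=> /row_freeP[B UB] Z Z'; rewrite [(Ubold U)^T]tr_kron_id.
move=> /(congr1 (@unstack _ _ _)); rewrite !unstack_kron_id => /(congr1 (mulmx B^T)).
by rewrite !mulmxA -trmx_mul UB trmx1 !mul1mx; exact: unstack_inj.
Qed.

Section Cones.
Variables (R : realType) (p q : nat).
Implicit Types y s : 'cV[R]_(p + q).

Lemma inner_Kpolar_Kcone y s : Kpolar y -> Kcone s -> inner y s <= 0.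
Proof.
move=> Ky [s0 sneg]; rewrite inner_vsubmx s0 inner0r add0r.
by apply: sumr_le0 => j _; rewrite mulr_ge0_le0.
Qed.

Lemma Kpolar_maximizer y s : Kpolar y ->
  (forall y', Kpolar y' -> inner y' s <= inner y s) -> Kcone s /\ inner y s = 0.
Proof.
move=> Ky ymax.
have K0 : Kpolar (0 : 'cV[R]_(p + q)) by move=> j; rewrite !mxE.
have K2y : Kpolar (2 *: y) by move=> j; rewrite !mxE mulr_ge0//; have := Ky j; rewrite mxE.
have ys0 : inner y s = 0.
  by have := ymax _ K0; have := ymax _ K2y; rewrite inner0l innerZl; lra.
split=> //; split=> [|j].
  apply/colP => j; rewrite [RHS]mxE; set a := usubmx s j 0.
  have : Kpolar (col_mx (a *: delta_mx j 0) 0 : 'cV[R]_(p + q)).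
    by move=> i; rewrite col_mxKd mxE.
  move=> /ymax; rewrite ys0 inner_vsubmx col_mxKu col_mxKd inner0l addr0 innerZl innerC.
  rewrite inner_delta -/a -expr2 => a2_le0.
  by apply/eqP; rewrite -sqrf_eq0 eq_le a2_le0 sqr_ge0.
have : Kpolar (col_mx 0 (delta_mx j 0) : 'cV[R]_(p + q)).
  by move=> i; rewrite col_mxKd mxE; case: (_ && _).
move=> /ymax; rewrite ys0 inner_vsubmx col_mxKu col_mxKd inner0l add0r innerC.
by rewrite inner_delta.
Qed.

End Cones.

Lemma separable_min (R : numDomainType) (I : finType) (T : I -> Type)
    (C : forall i, set (T i)) (f : forall i, T i -> R) (x : forall i, T i) :
  (forall i, C i (x i)) ->
  (forall x', (forall i, C i (x' i)) -> \sum_i f i (x i) <= \sum_i f i (x' i)) ->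
  forall i z, C i z -> f i (x i) <= f i z.
Proof.
move=> Cx xmin i z Cz.
have := xmin (eqtype.dfwith x z); rewrite (bigD1 i)//= [leRHS](bigD1 i)//=.
rewrite eqtype.dfwith_in [X in _ <= _ + X](eq_bigr (fun j => f j (x j))) => [|j ji].
  rewrite lerD2r; apply=> j; have [<-|ij] := eqVneq i j; first by rewrite eqtype.dfwith_in.
  by rewrite eqtype.dfwith_out.
by rewrite eqtype.dfwith_out// eq_sym.
Qed.

Section Duality.
Variables (R : realType) (P : Problem R).
Local Notation m := (pm P).
Local Notation d := (pp P + pq P)%N.
Implicit Types (x : 'cV[R]_(nx P)) (Y : 'cV[R]_(ny P)) (y : 'cV[R]_d).

Hypothesis m0 : (0 < m)%N.

Lemma dual_fun_Ny y : ~ Kpolar y -> dual_fun y = -oo%E.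
Proof.
move=> Ky; apply/esum_eqNyP; exists (Ordinal m0); split=> //.
by apply/eqP; rewrite -leeNy_eq; apply: ereal_inf_lbound; exists 0 => //; rewrite ell_Ny.
Qed.

Lemma weak_duality x y : feasible x -> (dual_fun y <= (Fobj x)%:E)%E.
Proof.
move=> [sK Ox]; have [Ky|Ky] := pselect (Kpolar y); last by rewrite dual_fun_Ny// leNye.
apply: (@le_trans _ _ (\sum_(i < m) ell (xblk x i) y)%E).
  by apply: lee_sum => i _; apply: ereal_inf_lbound; exists (xblk x i).
under eq_bigr do rewrite ell_fin//.
rewrite sumEFin lee_fin big_split/= -inner_sumr.
by have := inner_Kpolar_Kcone Ky sK; rewrite /Fobj; lra.
Qed.

Lemma dual_fun_lagrangian_min x y : in_Omega x -> Kpolar y ->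
  (forall x', in_Omega x' -> lagrangian x (ones_kron y) <= lagrangian x' (ones_kron y)) ->
  ((lagrangian x (ones_kron y))%:E <= dual_fun y)%E.
Proof.
move=> Ox Ky xmin; rewrite -sumEFin; apply: lee_sum => i _.
apply: le_ereal_inf_tmp => _ [z _ <-]; rewrite yblk_ones_kron.
have [Oz|Oz] := pselect (pOmega P i z); last by rewrite (ell_y Oz)// leey.
rewrite ell_fin// lee_fin.
apply: (separable_min (f := fun i z => pf P i z + inner y (Gi z)) Ox _ Oz) => x' Ox'.
have x'E j : xblk (\mxcol_j x' j) j = x' j by exact: mxcolK.
have Ox'_mx : in_Omega (\mxcol_j x' j) by move=> j; rewrite x'E.
have := xmin _ Ox'_mx; rewrite /lagrangian.
under [X in _ <= X -> _]eq_bigr do rewrite yblk_ones_kron x'E.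
by under [X in X <= _ -> _]eq_bigr do rewrite yblk_ones_kron.
Qed.

Variables (r : nat) (U : 'M[R]_(r, m)).
Hypothesis kerU : kernel_ones U.

Lemma saddle_point_optimal x Y Z : saddle_point U x Y Z ->
  primal_optimal x /\ exists y, Y = ones_kron y /\ dual_optimal y.
Proof.
move=> [Ox KY UY saddle]; have [y Yy] := Ubold_ker kerU UY; subst Y.
have Ky : Kpolar y by rewrite -(yblk_ones_kron y (Ordinal m0)); exact: KY.
have xmin x' : in_Omega x' -> lagrangian x (ones_kron y) <= lagrangian x' (ones_kron y).
  by move=> Ox'; have := saddle x' _ Ox' KY; rewrite UY inner0l addr0.
have [sK ys] : Kcone (\sum_i Gi (xblk x i)) /\ inner y (\sum_i Gi (xblk x i)) = 0.
  apply: Kpolar_maximizer => // y' Ky'.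
  have := saddle x _ Ox (in_Kpolar_ones_kron Ky').
  by rewrite !lagrangian_ones_kron Ubold_ones_kron// inner0l addr0 lerD2l.
have xopt : lagrangian x (ones_kron y) = Fobj x by rewrite lagrangian_ones_kron ys addr0.
split.
  split=> // x' [sK' Ox']; rewrite -xopt; apply: le_trans (xmin x' Ox') _.
  by rewrite lagrangian_ones_kron; have := inner_Kpolar_Kcone Ky sK'; lra.
exists y; split=> // y'; apply: le_trans (weak_duality y' (conj sK Ox)) _.
by rewrite -xopt; exact: dual_fun_lagrangian_min.
Qed.

Lemma saddle_point_of_multiplier x y : in_Omega x -> Kpolar y ->
  Kcone (\sum_i Gi (xblk x i)) ->
  (forall x', in_Omega x' -> Fobj x <= lagrangian x' (ones_kron y)) ->
  exists Z, saddle_point U x (ones_kron y) Z.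
Proof.
move=> Ox Ky sK xmin; set s := \sum_i _ in sK.
have mV : m%:R != 0 :> R by rewrite pnatr_eq0 -lt0n.
pose W : 'cV[R]_(ny P) :=
  @mxcol R m (fun=> d) 1 (fun i => Gi (xblk x i) - m%:R^-1 *: s).
have W_blk i : yblk W i = Gi (xblk x i) - m%:R^-1 *: s by exact: mxcolK.
have W0 : \sum_i yblk W i = 0.
  under eq_bigr do rewrite W_blk.
  by rewrite sumrB sumr_const card_ord -scaler_nat scalerA divff// scale1r subrr.
have [Z WZ] := trUbold_range kerU W0.
exists Z; split=> //; [exact: in_Kpolar_ones_kron|exact: Ubold_ones_kron|].
move=> x' Y' Ox' KY'; rewrite inner_mulmxl WZ (inner_submxcol (p_ := fun=> d)).
apply: le_trans (_ : _ <= Fobj x + \sum_i inner (yblk Y' i) (yblk W i)) _; last first.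
  by rewrite lerD2r; exact: xmin.
rewrite -big_split/=; apply: ler_sum => i _; rewrite W_blk innerBr innerZr lerD2l.
have m0V : 0 <= m%:R^-1 :> R by rewrite invr_ge0.
by have := mulr_ge0_le0 m0V (inner_Kpolar_Kcone (KY' i) sK); lra.
Qed.

End Duality.

Section Slater.
Variables (R : realType) (P : Problem R).
Local Notation m := (pm P).
Local Notation d := (pp P + pq P)%N.
Implicit Types x xo xb : 'cV[R]_(nx P).
Hypothesis P_convex : convex_problem P.

Lemma sum_Gi x : \sum_i Gi (xblk x i) =
  col_mx (\sum_(i < m) (pA P i *m xblk x i - pb P i)) (\sum_(i < m) pg P i (xblk x i)).
Proof. by elim/big_rec3: _ => [|i a b c _ ->]; rewrite ?col_mx0// add_col_mx. Qed.

Lemma convex_fun_xblk i (f : 'cV[R]_(pn P i) -> R) :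
  convex_fun f -> convex_fun (fun x => f (xblk x i)).
Proof. by move=> f_cvx u v t t0 t1; rewrite xblk_comb; exact: f_cvx. Qed.

Lemma convex_in_Omega : convex_set_cV (@in_Omega R P).
Proof.
have [_ _ Oc] := P_convex; move=> u v t Ou Ov t0 t1 i.
by rewrite xblk_comb; exact: Oc.
Qed.

Lemma affine_equality_constraint j :
  affine_fun (fun x => (\sum_(i < m) (pA P i *m xblk x i - pb P i)) j 0).
Proof.
under eq_fun do rewrite summxE; apply: affine_fun_sum => i u v t.
by rewrite xblk_comb mulmxDr -!scalemxAr !mxE; ring.
Qed.

Lemma in_Omega_extends_beyond xb :
  (forall i, (pOmega P i)^° (xblk xb i)) -> extends_beyond (@in_Omega R P) xb.
Proof.
move=> xb_int x _.
pose ext i (e : R) := pOmega P i ((- e) *: xblk x i + (1 + e) *: xblk xb i).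
have near_ext : \forall e \near 0^'+, forall i, ext i e.
  by apply: (@filter_forall _ _ ext) => i; exact: interior_extends_beyond.
have [e [e0 e_ext]] := filter_ex (filterI (nbhs_right_gt 0) near_ext).
by exists e => // i; rewrite xblk_comb; exact: e_ext.
Qed.

Lemma slater_multiplier xo xb : primal_optimal xo ->
  (forall i, (pOmega P i)^° (xblk xb i)) ->
  \sum_(i < m) (pA P i *m xblk xb i - pb P i) = 0 ->
  (forall j : 'I_(pq P), (\sum_(i < m) pg P i (xblk xb i)) j 0 < 0) ->
  exists2 y : 'cV[R]_d, Kpolar y &
    forall x, in_Omega x -> Fobj xo <= lagrangian x (ones_kron y).
Proof.
move=> [_ xo_min] xb_int xbA xbg; have [fc gc _] := P_convex.
pose h j x := (\sum_(i < m) (pA P i *m xblk x i - pb P i)) j 0.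
pose g j x := (\sum_(i < m) pg P i (xblk x i)) j 0.
have gap_convex : convex_fun (fun x => Fobj x - Fobj xo).
  apply: convex_funD; last by move=> u v t _ _; lra.
  by apply: convex_fun_sum => i; exact: convex_fun_xblk.
have g_convex j : convex_fun (g j).
  rewrite /g; under eq_fun do rewrite summxE.
  by apply: convex_fun_sum => i; exact: (convex_fun_xblk (gc i j)).
have hxb j : h j xb = 0 by rewrite /h xbA mxE.
have [||mu [nu [nu0 mult]]] := lagrange_multipliers convex_in_Omega gap_convex
    affine_equality_constraint g_convex _ hxb xbg (in_Omega_extends_beyond xb_int).
- by move=> i; exact: interior_subset.
- move=> x Ox hx gx; rewrite subr_ge0; apply: xo_min; split=> //.
  rewrite sum_Gi; split=> [|j]; last by rewrite col_mxKd; exact: gx.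
  by rewrite col_mxKu; apply/colP => j; rewrite [RHS]mxE; exact: hx.
exists (col_mx (\col_j mu j) (\col_j nu j)) => [j|x Ox]; first by rewrite col_mxKd mxE.
rewrite lagrangian_ones_kron sum_Gi inner_col_mx /inner.
under eq_bigr do rewrite mxE; under [X in _ <= _ + (_ + X)]eq_bigr do rewrite mxE.
by have := mult x Ox; lra.
Qed.

Lemma slater_saddle_point r (U : 'M[R]_(r, m)) : (0 < m)%N -> kernel_ones U ->
  (exists xo, primal_optimal xo) ->
  (exists xb, [/\ (forall i, (pOmega P i)^° (xblk xb i)),
     \sum_(i < m) (pA P i *m xblk xb i - pb P i) = 0 &
     forall j : 'I_(pq P), (\sum_(i < m) pg P i (xblk xb i)) j 0 < 0]) ->
  Phi_zeros (P := P) U !=set0.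
Proof.
move=> m0 kerU [xo xo_opt] [xb [xb_int xbA xbg]].
have [y Ky ymult] := slater_multiplier xo_opt xb_int xbA xbg.
have [[sK Oxo] _] := xo_opt.
have [Z saddle] := saddle_point_of_multiplier m0 kerU Oxo Ky sK ymult.
exists (stack xo (ones_kron y) Z); apply/Phi_zerosP.
by rewrite /stack !(col_mxKu, col_mxKd).
Qed.

End Slater.

Section ConeProjection.
Variables (R : realType) (p q : nat).
Implicit Types u v w y : 'cV[R]_(p + q).

Lemma usubmx_projKpolar u : usubmx (projKpolar u) = usubmx u.
Proof. exact: col_mxKu. Qed.

Lemma dsubmx_projKpolar u j : dsubmx (projKpolar u) j 0 = Num.max (dsubmx u j 0) 0.
Proof. by rewrite /projKpolar col_mxKd mxE. Qed.

Lemma dsubmxB_coord u v j : dsubmx (u - v) j 0 = dsubmx u j 0 - dsubmx v j 0.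
Proof. by rewrite !mxE. Qed.

Lemma Kpolar_projKpolar u : Kpolar (projKpolar u).
Proof. by move=> j; rewrite dsubmx_projKpolar le_max lexx orbT. Qed.

Lemma KconeZ c u : 0 <= c -> Kcone u -> Kcone (c *: u).
Proof.
move=> c0 [u0 u_le0]; split=> [|j]; first by rewrite linearZ/= u0 scaler0.
by have := u_le0 j; rewrite !mxE => /(mulr_ge0_le0 c0).
Qed.

Lemma projKpolar_obtuse u y : Kpolar y ->
  0 <= inner (y - projKpolar u) (projKpolar u - u).
Proof.
move=> Ky; rewrite inner_vsubmx !linearB/= usubmx_projKpolar subrr inner0r add0r.
apply: sumr_ge0 => j _; have := Ky j; rewrite -!linearB/= !dsubmxB_coord dsubmx_projKpolar.
by have [uj|uj] := leP (dsubmx u j 0) 0; nra.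
Qed.

Lemma projKpolar_step_vi c yk lam g yh y : 0 < c ->
  yh = projKpolar (yk - c *: lam + c *: g) -> Kpolar y ->
  0 <= inner yh g - inner y g + inner (yh - y) (c^-1 *: (yk - yh) - lam).
Proof.
move=> c0 yhE Ky; rewrite -innerBl -innerDr -(pmulr_rge0 _ c0) -innerZr.
rewrite -(opprB y) innerNl -innerNr.
have -> : - (c *: (g + (c^-1 *: (yk - yh) - lam))) = yh - (yk - c *: lam + c *: g).
  by apply/colP => j; rewrite !mxE; field; rewrite gt_eqF.
by rewrite yhE; exact: projKpolar_obtuse.
Qed.

(* [|P u|^2] is monotone in the last [q] coordinates and has the 2-Lipschitz
   gradient [2 P u]. *)
Lemma projKpolar_sqr_le u v w : Kcone (v - w) ->
  inner (projKpolar v) (projKpolar v) <=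
  inner (projKpolar u) (projKpolar u) + 2 * inner (projKpolar u) (w - u)
  + inner (w - u) (w - u).
Proof.
move=> [vw_eq vw_le]; have {}vw_eq : usubmx v = usubmx w.
  by apply: subr0_eq; rewrite -[RHS]vw_eq linearB.
rewrite !inner_vsubmx !usubmx_projKpolar vw_eq mulrDr.
rewrite [X in _ <= X + _]addrACA [leRHS]addrACA lerD//.
  by rewrite -inner_sqrD addrC -linearD/= subrK lexx.
rewrite /inner mulr_sumr -!big_split/=; apply: ler_sum => j _.
have := vw_le j; rewrite !dsubmxB_coord !dsubmx_projKpolar.
move: (dsubmx v j 0) (dsubmx w j 0) (dsubmx u j 0) => a b c ab.
have [a0|a0] := leP a 0; have [c0|c0] := leP c 0.
- by have := sqr_ge0 (b - c); lra.
- by have := sqr_ge0 b; lra.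
- have : 0 <= (b - c - a) * (b - c + a) by rewrite mulr_ge0//; lra.
  by lra.
- have : 0 <= (b - a) * (b + a) by rewrite mulr_ge0//; lra.
  by lra.
Qed.

End ConeProjection.

Lemma le0_of_le_scaled (R : realFieldType) (a c : R) :
  (forall t, 0 < t -> t <= 1 -> a <= t * c) -> a <= 0.
Proof.
move=> a_le; rewrite leNgt; apply/negP => a0.
have c0 : 0 < c by have := a_le 1 ltr01 (lexx _); lra.
have t0 : 0 < a / (2 * c) by rewrite divr_gt0// mulr_gt0.
have t1 : a / (2 * c) <= 1.
  by rewrite ler_pdivrMr ?mulr_gt0//; have := a_le 1 ltr01 (lexx _); lra.
have := a_le _ t0 t1; have -> : a / (2 * c) * c = a / 2 by field; rewrite gt_eqF.
by lra.
Qed.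

(* The quadratic remainder of [psi] is negligible along the segment from [xh]
   to [z]. *)
Lemma first_order_optimality (R : realType) N (X : set 'cV[R]_N)
    (f psi : 'cV[R]_N -> R) (xh z v : 'cV[R]_N) (slope c : R) :
  convex_set_cV X -> convex_fun f -> X xh -> X z ->
  (forall u, X u -> f xh + psi xh + inner v (u - xh) <= f u + psi u) ->
  (forall t, 0 <= t -> t <= 1 ->
     psi (t *: z + (1 - t) *: xh) <= psi xh + t * slope + t ^+ 2 * c) ->
  inner v (z - xh) <= f z - f xh + slope.
Proof.
move=> Xc f_cvx Xxh Xz v_sub psi_le; rewrite -subr_le0.
apply: (@le0_of_le_scaled _ _ c) => t t0 t1; have t0' := ltW t0.
have := v_sub _ (Xc z xh t Xz Xxh t0' t1); have := f_cvx z xh t t0' t1.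
have -> : t *: z + (1 - t) *: xh - xh = t *: (z - xh).
  by rewrite scalerBl scale1r addrA addrAC addrK scalerBr.
have := psi_le t t0' t1; rewrite innerZr => psi_t f_t v_t.
by rewrite -(ler_pM2l t0); lra.
Qed.

Section AgentStep.
Variables (R : realType) (P : Problem R).
Local Notation m := (pm P).
Local Notation d := (pp P + pq P)%N.
Variables alpha gamma : 'I_m -> R.
Hypothesis alpha0 : forall i, 0 < alpha i.
Hypothesis gamma0 : forall i, 0 < gamma i.
Hypothesis P_convex : convex_problem P.

Variables (i : 'I_m) (xk : 'cV[R]_(pn P i)) (y : 'cV[R]_d).

Definition dual_step (x : 'cV[R]_(pn P i)) : 'cV[R]_d :=
  projKpolar (y + gamma i *: Gi x).

Definition smooth_part (x : 'cV[R]_(pn P i)) : R :=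
  (2 * gamma i)^-1 * (inner (dual_step x) (dual_step x) - inner y y)
  + (2 * alpha i)^-1 * inner (x - xk) (x - xk).

Lemma phik_fin x : pOmega P i x ->
  phik alpha gamma xk y x = (pf P i x + smooth_part x)%:E.
Proof. by move=> Ox; rewrite /phik /Defs.indic (asboolT Ox) adde0 !enorm_sqr addrA. Qed.

Lemma phik_subdiff_Omega x v : subdiff (phik alpha gamma xk y) x v -> pOmega P i x.
Proof. by case=> + _; rewrite /phik /Defs.indic; case: asboolP. Qed.

Lemma Gi_Kconvex (z x : 'cV[R]_(pn P i)) t : 0 <= t -> t <= 1 ->
  Kcone (Gi (t *: z + (1 - t) *: x) - (t *: Gi z + (1 - t) *: Gi x)).
Proof.
move=> t0 t1; have [_ gc _] := P_convex.
rewrite /Gi !scale_col_mx add_col_mx opp_col_mx add_col_mx.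
split=> [|j]; last by rewrite col_mxKd !mxE subr_le0; exact: gc.
rewrite col_mxKu mulmxDr -!scalemxAr; apply/colP => j; rewrite !mxE.
by ring.
Qed.

Lemma dual_step_segment_le (z x : 'cV[R]_(pn P i)) t : 0 <= t -> t <= 1 ->
  inner (dual_step (t *: z + (1 - t) *: x)) (dual_step (t *: z + (1 - t) *: x)) <=
  inner (dual_step x) (dual_step x) + 2 * (gamma i * t) * inner (dual_step x) (Gi z - Gi x)
  + (gamma i * t) ^+ 2 * inner (Gi z - Gi x) (Gi z - Gi x).
Proof.
move=> t0 t1; set zt := t *: z + _; set u := y + gamma i *: Gi x.
have zt_Kle : Kcone ((y + gamma i *: Gi zt) - (u + (gamma i * t) *: (Gi z - Gi x))).
  rewrite (_ : _ - _ = gamma i *: (Gi zt - (t *: Gi z + (1 - t) *: Gi x))).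
    by apply: KconeZ; [exact: ltW|exact: Gi_Kconvex].
  by rewrite /u; apply/colP => j; rewrite ![in RHS]mxE ![in LHS]mxE; ring.
apply: le_trans (projKpolar_sqr_le u zt_Kle) _; rewrite (addrC u) addrK.
by rewrite !innerZr innerZl -/(dual_step x); lra.
Qed.

Lemma smooth_part_segment_le (z x : 'cV[R]_(pn P i)) t : 0 <= t -> t <= 1 ->
  smooth_part (t *: z + (1 - t) *: x) <= smooth_part x
  + t * (inner (dual_step x) (Gi z - Gi x) + (alpha i)^-1 * inner (x - xk) (z - x))
  + t ^+ 2 * (gamma i / 2 * inner (Gi z - Gi x) (Gi z - Gi x)
              + (2 * alpha i)^-1 * inner (z - x) (z - x)).
Proof.
move=> t0 t1; have gV0 : 0 <= (2 * gamma i)^-1 by rewrite invr_ge0 mulr_ge0// ltW.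
have penalty_le := ler_wpM2l gV0 (dual_step_segment_le z x t0 t1).
have prox_eq : inner (t *: z + (1 - t) *: x - xk) (t *: z + (1 - t) *: x - xk) =
    inner (x - xk) (x - xk) + 2 * (t * inner (x - xk) (z - x))
    + t ^+ 2 * inner (z - x) (z - x).
  have -> : t *: z + (1 - t) *: x - xk = (x - xk) + t *: (z - x).
    by rewrite scalerBr scalerBl scale1r addrCA addrAC.
  by rewrite inner_sqrD !innerZr innerZl; ring.
rewrite /smooth_part prox_eq mulrBr.
have [gi0 ai0] : gamma i != 0 /\ alpha i != 0 by rewrite !gt_eqF.
apply: le_trans (lerD (lerB penalty_le (lexx _)) (lexx _)) _.
by rewrite le_eqVlt; apply/predU1P; left; field; rewrite gi0 ai0.
Qed.

Lemma agent_primal_vi (xh v z : 'cV[R]_(pn P i)) :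
  subdiff (phik alpha gamma xk y) xh v -> pOmega P i z ->
  0 <= (pf P i z + inner (dual_step xh) (Gi z)) - (pf P i xh + inner (dual_step xh) (Gi xh))
       + inner (xh - z) ((alpha i)^-1 *: (xk - xh) + v).
Proof.
move=> v_subdiff Oz; have Oxh := phik_subdiff_Omega v_subdiff; have [fc _ Oc] := P_convex.
have v_sub u : pOmega P i u ->
    pf P i xh + smooth_part xh + inner v (u - xh) <= pf P i u + smooth_part u.
  by move=> Ou; have := v_subdiff.2 u; rewrite !phik_fin// -EFinD lee_fin.
have inner_split : inner (xh - z) ((alpha i)^-1 *: (xk - xh) + v) =
    (alpha i)^-1 * inner (xh - xk) (z - xh) - inner v (z - xh).
  rewrite -(opprB z xh) -(opprB xh xk) scalerN innerNl (innerDr _ v) innerNr innerZr.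
  by rewrite (innerC v) (innerC (xh - xk)); ring.
have := first_order_optimality (Oc i) (fc i) Oxh Oz v_sub
  (fun t t0 t1 => smooth_part_segment_le z xh t0 t1).
by rewrite inner_split (innerBr _ _ (dual_step xh)); lra.
Qed.

End AgentStep.

Section Metric.
Variables (R : realType) (P : Problem R) (r : nat) (U : 'M[R]_(r, pm P)).
Local Notation m := (pm P).
Local Notation d := (pp P + pq P)%N.
Variables (theta alpha gamma : 'I_m -> R) (beta : R).
Hypothesis theta0 : forall i, 0 < theta i.
Hypothesis alpha0 : forall i, 0 < alpha i.
Hypothesis gamma0 : forall i, 0 < gamma i.
Hypothesis beta0 : 0 < beta.

Local Notation H := (H_mx U theta alpha gamma beta).
Local Notation D := (D_mx U theta alpha gamma beta).
Local Notation Q := (Q_mx U alpha gamma beta).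
Local Notation M := (M_mx U theta gamma).
Implicit Types (x : 'cV[R]_(nx P)) (Y : 'cV[R]_(ny P)) (Z : 'cV[R]_(nz P r)).

Let neq0 (a : 'I_m -> R) : (forall i, 0 < a i) -> forall i, a i != 0.
Proof. by move=> a0 i; rewrite gt_eqF. Qed.

Lemma stackK (e : 'cV[R]_(nx P + (ny P + nz P r))) :
  stack (usubmx e) (usubmx (dsubmx e)) (dsubmx (dsubmx e)) = e.
Proof. by rewrite /stack !vsubmxK. Qed.

Lemma stackB x Y Z x' Y' Z' :
  stack x Y Z - stack x' Y' Z' = stack (x - x') (Y - Y') (Z - Z').
Proof. by rewrite /stack !opp_col_mx !add_col_mx. Qed.

Lemma stack_eq0 x Y Z : (stack x Y Z == 0) = [&& x == 0, Y == 0 & Z == 0].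
Proof. by rewrite /stack !col_mx_eq0. Qed.

Lemma Ups_mx_inv : invmx (Ups_mx alpha) = mxdiag_scalar (pn P) (fun i => (alpha i)^-1).
Proof. exact: (invmx_mxdiag_scalar _ (neq0 alpha0)). Qed.

Lemma Gam_mx_inv : invmx (Gam_mx gamma) = mxdiag_scalar (fun=> d) (fun i => (gamma i)^-1).
Proof. exact: (invmx_mxdiag_scalar _ (neq0 gamma0)). Qed.

Definition H_diag : 'M[R]_(nx P + (ny P + nz P r)) :=
  block_mx (mxdiag_scalar (pn P) (fun i => (alpha i)^-1 * (theta i)^-1)) 0 0
    (block_mx (mxdiag_scalar (fun=> d) (fun i => (gamma i)^-1)) 0 0 (beta^-1)%:M).

Lemma H_diag_mul_M : H_diag *m M = Q.
Proof.
rewrite /H_diag /M_mx /Q_mx Ups_mx_inv Gam_mx_inv !mulmx_block.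
rewrite !(mul0mx, mulmx0, mulmx1, addr0, add0r).
congr (block_mx _ 0 0 (block_mx _ _ 0 _)).
  rewrite [LHS]mxdiag_scalarM; congr mxdiag_scalar; apply/funext => i.
  by rewrite -mulrA mulVf ?mulr1// neq0.
by rewrite mulmxN mulmxA -Gam_mx_inv mulVmx ?mul1mx// mxdiag_scalar_unit// => i; exact: neq0.
Qed.

Lemma H_mxE : H = H_diag.
Proof.
rewrite /H_mx -H_diag_mul_M mulmxK// unitmxE /M_mx !det_ublock !det1 !mulr1 -unitmxE.
by apply: mxdiag_scalar_unit => i; exact: neq0.
Qed.

Lemma H_mul_M : H *m M = Q.
Proof. by rewrite H_mxE H_diag_mul_M. Qed.

Lemma H_sym : H^T = H.
Proof. by rewrite H_mxE /H_diag !tr_block_mx !trmx0 !tr_mxdiag_scalar tr_scalar_mx. Qed.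

Local Notation xdiag := (mxdiag_scalar (pn P)).
Local Notation ydiag := (mxdiag_scalar (fun=> d)).

Lemma sqnormA_H x Y Z : sqnormA H (stack x Y Z) =
  sqnormA (xdiag (fun i => (alpha i)^-1 * (theta i)^-1)) x
  + (sqnormA (ydiag (fun i => (gamma i)^-1)) Y + beta^-1 * inner Z Z).
Proof.
rewrite /sqnormA H_mxE /H_diag /stack !mul_block_col !mul0mx !addr0 !add0r.
by rewrite !inner_col_mx mul_scalar_mx innerZr.
Qed.

Lemma inner_stack_Q x' Y' Z' x Y Z : inner (stack x' Y' Z') (Q *m stack x Y Z) =
  inner x' (xdiag (fun i => (alpha i)^-1) *m x)
  + (inner Y' (ydiag (fun i => (gamma i)^-1) *m Y) - inner (Ubold U *m Y') Z
     + beta^-1 * inner Z' Z).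
Proof.
rewrite /Q_mx /stack Ups_mx_inv Gam_mx_inv !mul_block_col !mul0mx !addr0 !add0r.
by rewrite !inner_col_mx innerDr mulNmx innerNr mul_scalar_mx innerZr inner_mulmxl.
Qed.

Lemma M_mul_stack x Y Z : M *m stack x Y Z =
  stack (Theta_mx theta *m x) (Y - Gam_mx gamma *m ((Ubold U)^T *m Z)) Z.
Proof.
by rewrite /M_mx /stack !mul_block_col !mul0mx !addr0 !add0r mulNmx !mul1mx mulmxA.
Qed.

Lemma sqnormA_D x Y Z : sqnormA D (stack x Y Z) =
  sqnormA (xdiag (fun i => (alpha i)^-1 * (2 - theta i))) x
  + (sqnormA (ydiag (fun i => (gamma i)^-1)) Y
     + (beta^-1 * inner Z Z - sqnormA (Gam_mx gamma) ((Ubold U)^T *m Z))).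
Proof.
rewrite (sqnormA_prediction H_mul_M) inner_stack_Q M_mul_stack sqnormA_H.
set W := (Ubold U)^T *m Z.
have -> : sqnormA (xdiag (fun i => (alpha i)^-1 * (theta i)^-1)) (Theta_mx theta *m x) =
    2 * inner x (xdiag (fun i => (alpha i)^-1) *m x)
    - sqnormA (xdiag (fun i => (alpha i)^-1 * (2 - theta i))) x.
  rewrite /sqnormA !inner_mxdiag_scalar mulr_sumr -sumrB; apply: eq_bigr => i _.
  by rewrite submxcol_mxdiag_scalar innerZl innerZr; field; rewrite !neq0.
have -> : sqnormA (ydiag (fun i => (gamma i)^-1)) (Y - Gam_mx gamma *m W) =
    sqnormA (ydiag (fun i => (gamma i)^-1)) Y - 2 * inner Y W + sqnormA (Gam_mx gamma) W.
  rewrite /sqnormA !inner_mxdiag_scalar (inner_submxcol (p_ := fun=> d) Y).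
  rewrite mulr_sumr -sumrB -big_split/=; apply: eq_bigr => i _.
  rewrite submxcolB submxcol_mxdiag_scalar inner_sqrB !innerZr innerZl.
  by field; rewrite neq0.
by rewrite inner_mulmxl -/W /sqnormA; lra.
Qed.

Lemma pos_def_stack (A : 'M[R]_(nx P + (ny P + nz P r))) (a b : 'I_m -> R)
    (c : 'cV[R]_(nz P r) -> R) :
  (forall i, 0 < a i) -> (forall i, 0 < b i) ->
  c 0 = 0 -> (forall Z, Z != 0 -> 0 < c Z) ->
  (forall x Y Z, sqnormA A (stack x Y Z) =
     sqnormA (xdiag a) x + (sqnormA (ydiag b) Y + c Z)) ->
  pos_def_mx A.
Proof.
move=> a0 b0 c0 c_gt0 AE e.
have c_ge0 Z : 0 <= c Z by have [->|/c_gt0/ltW//] := eqVneq Z 0; rewrite c0.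
have xdiag_pos := pos_def_mxdiag_scalar (p_ := pn P) a0.
have ydiag_pos := pos_def_mxdiag_scalar (p_ := fun=> d) b0.
rewrite -(stackK e) stack_eq0 AE !negb_and => /or3P[/xdiag_pos|/ydiag_pos|/c_gt0] pos.
- by rewrite ltr_wpDr// addr_ge0//; exact: pos_def_mx_ge0.
- by rewrite ltr_wpDl ?pos_def_mx_ge0// ltr_wpDr.
- by rewrite ltr_wpDl ?pos_def_mx_ge0// ltr_wpDl ?pos_def_mx_ge0.
Qed.

Lemma pos_def_H : pos_def_mx H.
Proof.
apply: (pos_def_stack _ _ _ _ sqnormA_H) => [i|i||Z Z0].
- by rewrite mulr_gt0 ?invr_gt0.
- by rewrite invr_gt0.
- by rewrite inner0l mulr0.
- by rewrite mulr_gt0 ?invr_gt0 ?inner_gt0.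
Qed.

Hypothesis theta2 : forall i, theta i < 2.
Hypothesis step_size : forall i, gamma i * beta < 1 / lambda_max (U^T *m U).

Lemma inner_trUbold_le Z : 0 <= lambda_max (U^T *m U) ->
  inner ((Ubold U)^T *m Z) ((Ubold U)^T *m Z) <= lambda_max (U^T *m U) * inner Z Z.
Proof.
move=> lam0; rewrite [(Ubold U)^T]tr_kron_id; apply: inner_kron_id_le.
apply: inner_trmx_le => // w; rewrite inner_mulmxl mulmxA.
by apply: rayleigh_le; rewrite trmx_mul trmxK.
Qed.

Lemma step_size_gap Z : Z != 0 ->
  0 < beta^-1 * inner Z Z - sqnormA (Gam_mx gamma) ((Ubold U)^T *m Z).
Proof.
move=> Z0; rewrite subr_gt0; set W := (Ubold U)^T *m Z; set lam := lambda_max (U^T *m U).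
have [W0|W0] := eqVneq W 0; first by rewrite W0 sqnormA0 mulr_gt0 ?invr_gt0 ?inner_gt0.
have lam_gt0 (i : 'I_m) : 0 < lam.
  by have := lt_trans (mulr_gt0 (gamma0 i) beta0) (step_size i); rewrite div1r invr_gt0.
have gap0 i : 0 < beta^-1 - gamma i * lam.
  rewrite subr_gt0 -(ltr_pM2r beta0) mulVf ?gt_eqF// mulrAC -(ltr_pdivlMr _ _ (lam_gt0 i)).
  exact: step_size.
have [i _] : exists i, yblk W i != 0.
  by apply/existsP; apply: contraNT W0 => /existsPn Wi; apply/eqP/yblkP => i;
    have /negPn/eqP -> := Wi i; rewrite [RHS]submxcol0.
have lam0 := lam_gt0 i; rewrite -(ltr_pM2r lam0) -mulrA (mulrC (inner Z Z)).
have bV0 : 0 <= beta^-1 by rewrite invr_ge0 ltW.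
apply: lt_le_trans (ler_wpM2l bV0 (inner_trUbold_le Z (ltW lam0))); rewrite -/W.
have := pos_def_mxdiag_scalar (p_ := fun=> d) gap0 W0.
rewrite /sqnormA !inner_mxdiag_scalar -subr_gt0 (inner_submxcol (p_ := fun=> d) W).
rewrite mulr_sumr mulr_suml -sumrB; congr (0 < _); apply: eq_bigr => j _.
by ring.
Qed.

Lemma pos_def_D : pos_def_mx D.
Proof.
apply: (pos_def_stack _ _ _ _ sqnormA_D) => [i|i||]; last exact: step_size_gap.
- by rewrite mulr_gt0 ?invr_gt0 ?subr_gt0.
- by rewrite invr_gt0.
- by rewrite mulmx0 sqnormA0 inner0l mulr0 subr0.
Qed.

End Metric.

Lemma closed_funP (R : realType) N (f : 'cV[R]_N -> R) : closed_fun f <->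
  forall u e, 0 < e -> \forall v \near u, f u - e < f v.
Proof.
split=> [f_lsc u e e0|f_lsc u a].
  have [|V Vu fV] := f_lsc u (f u - e); first by rewrite lte_fin; lra.
  by apply: filterS Vu => v /fV; rewrite lte_fin.
rewrite lte_fin => afu; have e0 : 0 < f u - a by rewrite subr_gt0.
exists [set v | a < f v] => [|v /=]; last by rewrite lte_fin.
by apply: filterS (f_lsc u _ e0) => v /=; rewrite subKr.
Qed.

Section ClosedFunctions.
Variables (R : realType) (N : nat).
Implicit Types f g : 'cV[R]_N -> R.

Lemma continuous_closed_fun f : continuous f -> closed_fun f.
Proof.
move=> f_cont; apply/closed_funP => u e e0.
have /cvgrPdist_lt/(_ e e0) := f_cont u; apply: filterS => v.
by rewrite ltr_norml => /andP[_]; lra.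
Qed.

Lemma closed_funD f g : closed_fun f -> closed_fun g -> closed_fun (fun u => f u + g u).
Proof.
move=> /closed_funP f_lsc /closed_funP g_lsc; apply/closed_funP => u e e0.
have e2 : 0 < e / 2 by rewrite divr_gt0.
by apply: filterS2 (f_lsc u _ e2) (g_lsc u _ e2) => v; lra.
Qed.

Lemma closed_fun_sum (I : finType) (f : I -> 'cV[R]_N -> R) :
  (forall i, closed_fun (f i)) -> closed_fun (fun u => \sum_i f i u).
Proof.
move=> f_lsc; elim: (index_enum I) => [|i s IHs].
  by under eq_fun do rewrite big_nil; apply: continuous_closed_fun; exact: cst_continuous.
by under eq_fun do rewrite big_cons; exact: closed_funD.
Qed.

Lemma closed_funZ c f : 0 <= c -> closed_fun f -> closed_fun (fun u => c * f u).
Proof.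
rewrite le_eqVlt => /predU1P[<- _|c0 /closed_funP f_lsc]; apply/closed_funP => u e e0.
  by apply: (@nearW _ (nbhs u)) => v; lra.
have := f_lsc u _ (divr_gt0 e0 c0); apply: filterS => v.
by rewrite -(ltr_pM2l c0) mulrBr mulrCA divff ?gt_eqF// mulr1.
Qed.

Lemma closed_fun_comp K (f : 'cV[R]_K -> R) (h : 'cV[R]_N -> 'cV[R]_K) :
  continuous h -> closed_fun f -> closed_fun (fun u => f (h u)).
Proof.
move=> h_cont /closed_funP f_lsc; apply/closed_funP => u e e0.
exact: h_cont (f_lsc (h u) e e0).
Qed.

Lemma closed_fun_le_lim (T : topologicalType) (F : set_system T) {FF : ProperFilter F}
    f (w : T -> 'cV[R]_N) (c : T -> R) l b :
  closed_fun f -> w @ F --> l -> (forall x, f (w x) <= c x) -> c @ F --> b -> f l <= b.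
Proof.
move=> /closed_funP f_lsc wl fc cb; apply/ler_addgt0Pr => e e0.
rewrite -lerBlDr; apply: (ler_cvg_to (cvg_cst _) cb).
have : \forall x \near F, f l - e < f (w x) by exact: wl (f_lsc l e e0).
by apply: filterS => x /ltW fl_lt; exact: le_trans fl_lt (fc x).
Qed.

End ClosedFunctions.

Definition closed_problem (R : realType) (P : Problem R) : Prop :=
  [/\ forall i, closed_fun (pf P i),
      forall i j, closed_fun (fun u => pg P i u j 0) &
      forall i, closed (pOmega P i)].

Section ClosedLagrangian.
Variables (R : realType) (P : Problem R).
Hypothesis P_closed : closed_problem P.

Lemma closed_fun_lagrangian (Y : 'cV[R]_(ny P)) : in_Kpolar Y ->
  closed_fun (fun x => lagrangian x Y).
Proof.
have [f_closed g_closed _] := P_closed; move=> KY; apply: closed_fun_sum => i.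
have blk_cont : continuous (fun x : 'cV[R]_(nx P) => xblk x i).
  by move=> x; apply: (@cvg_submxcol _ _ (nbhs x)); exact: cvg_id.
apply: (closed_fun_comp (f := fun xi => _ xi + inner _ (Gi xi))) => //.
apply: closed_funD => //; under eq_fun do rewrite inner_vsubmx /Gi col_mxKu col_mxKd.
apply: closed_funD.
  apply: continuous_closed_fun => x; apply: (@cvg_inner _ _ (nbhs x)); first exact: cvg_cst.
  by apply: cvgB; [apply: cvg_mulmx; exact: cvg_id|exact: cvg_cst].
by apply: closed_fun_sum => j; apply: closed_funZ; [exact: KY|exact: g_closed].
Qed.

Lemma cvg_lagrangian (T : Type) (F : set_system T) {FF : Filter F} x
    (Y : T -> 'cV[R]_(ny P)) (Y' : 'cV[R]_(ny P)) :
  Y @ F --> Y' -> lagrangian x (Y t) @[t --> F] --> lagrangian x Y'.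
Proof.
move=> YY'; apply: cvg_sumr => i; apply: cvgD; first exact: cvg_cst.
by apply: cvg_inner; [exact: cvg_submxcol|exact: cvg_cst].
Qed.

Lemma in_Omega_lim (T : Type) (F : set_system T) {FF : ProperFilter F}
    (x : T -> 'cV[R]_(nx P)) (x' : 'cV[R]_(nx P)) :
  (forall t, in_Omega (x t)) -> x @ F --> x' -> in_Omega x'.
Proof.
have [_ _ Oc] := P_closed; move=> Ox xx' i.
have xi_cvg : xblk (x t) i @[t --> F] --> xblk x' i by exact: cvg_submxcol.
apply: (@closed_cvg _ _ _ _ (fun t => xblk (x t) i) _ (Oc i) _ _ xi_cvg).
by apply: nearW => t; exact: Ox.
Qed.

Lemma in_Kpolar_lim (T : topologicalType) (F : set_system T) {FF : ProperFilter F}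
    (Y : T -> 'cV[R]_(ny P)) (Y' : 'cV[R]_(ny P)) :
  (forall t, in_Kpolar (Y t)) -> Y @ F --> Y' -> in_Kpolar Y'.
Proof.
move=> KY YY' i j.
have yij_cvg : dsubmx (yblk (Y t) i) j 0 @[t --> F] --> dsubmx (yblk Y' i) j 0.
  by apply: cvg_coord; apply: cvg_dsubmx; exact: cvg_submxcol.
apply: (@ler_cvg_to _ F _ _ (cst 0) _ _ _ (cvg_cst _) yij_cvg).
by apply: nearW => t; exact: KY.
Qed.

End ClosedLagrangian.

Lemma cvg_stack (R : realType) (P : Problem R) r (T : Type) (F : set_system T)
    {FF : Filter F} (x : T -> 'cV[R]_(nx P)) (Y : T -> 'cV[R]_(ny P))
    (Z : T -> 'cV[R]_(nz P r)) (l : 'cV[R]_(nx P + (ny P + nz P r))) :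
  stack (x t) (Y t) (Z t) @[t --> F] --> l ->
  [/\ x @ F --> usubmx l, Y @ F --> usubmx (dsubmx l) & Z @ F --> dsubmx (dsubmx l)].
Proof.
move=> stack_l; split.
- have := cvg_usubmx stack_l; rewrite /stack; under eq_fun do rewrite col_mxKu; exact.
- have := cvg_usubmx (cvg_dsubmx stack_l).
  by rewrite /stack; under eq_fun do rewrite col_mxKd col_mxKu; exact.
- have := cvg_dsubmx (cvg_dsubmx stack_l).
  by rewrite /stack; under eq_fun do rewrite !col_mxKd; exact.
Qed.

Lemma sum_sqr_le (R : realDomainType) (I : finType) (a : I -> R) :
  (forall i, 0 <= a i) -> \sum_i a i ^+ 2 <= (\sum_i a i) ^+ 2.
Proof.
move=> a0; rewrite [leRHS]expr2 mulr_suml; apply: ler_sum => i _.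
by rewrite expr2 ler_wpM2l// (bigD1 i)//= lerDl sumr_ge0.
Qed.

Lemma is_cvg_series_sum (R : realType) (I : finType) (u : I -> nat -> R) :
  (forall i, cvgn (series (u i))) -> cvgn (series (fun k => \sum_i u i k)).
Proof.
move=> sum_u; have -> : series (fun k => \sum_i u i k) = (fun k => \sum_i series (u i) k).
  by apply/funext => k; rewrite /series/= exchange_big.
by apply/cvg_ex; exists (\sum_i limn (series (u i))); exact: cvg_sumr.
Qed.

Section Algorithm.
Variables (R : realType) (P : Problem R) (r : nat) (U : 'M[R]_(r, pm P)).
Local Notation m := (pm P).
Local Notation d := (pp P + pq P)%N.
Variables (theta alpha gamma : 'I_m -> R) (beta : R) (eps : 'I_m -> nat -> R).
Variables (x xh v : nat -> 'cV[R]_(nx P)) (Y Yh Lam : nat -> 'cV[R]_(ny P)).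
Variables (Z Zh : nat -> 'cV[R]_(nz P r)).
Hypothesis m0 : (0 < m)%N.
Hypothesis U_free : row_free U.
Hypothesis algo :
  inexact_DPMM U (U^T *m U) theta alpha gamma beta eps x xh v Y Yh Lam Z Zh.

Local Notation H := (H_mx U theta alpha gamma beta).
Local Notation D := (D_mx U theta alpha gamma beta).
Local Notation Q := (Q_mx U alpha gamma beta).
Local Notation M := (M_mx U theta gamma).
Local Notation xi k := (stack (x k) (Y k) (Z k)).
Local Notation xih k := (stack (xh k) (Yh k) (Zh k)).
Local Notation V k := (col_mx (v k) 0 : 'cV[R]_(nx P + (ny P + nz P r))).

Lemma Lam_Z k : Lam k = (Ubold U)^T *m Z k.
Proof. by case: algo => _ _ _ /(_ k (Ordinal m0)) [_ [_ []]]. Qed.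

Lemma Zh_succ k : Zh k = Z k.+1.
Proof.
apply: (trUbold_inj U_free); rewrite -Lam_Z.
by case: algo => _ _ _ /(_ k (Ordinal m0)) [_ [_ [_ ->]]].
Qed.

Lemma Zh_step k : Zh k = Z k + beta *: (Ubold U *m Yh k).
Proof.
rewrite Zh_succ; apply: (trUbold_inj U_free).
rewrite mulmxDr -scalemxAr -!Lam_Z [(Ubold U)^T]tr_kron_id -kron_id_mulA.
apply: yblkP => i; have [_ _ _ /(_ k i) [_ [[_ _ -> _] _]]] := algo.
by rewrite [RHS]submxcolD submxcolZ submxcol_kron_id.
Qed.

Lemma xi_step k : xi k.+1 = xi k - M *m (xi k - xih k).
Proof.
rewrite stackB M_mul_stack stackB; congr stack; last by rewrite subKr Zh_succ.
- apply/(@mxcolP _ m (pn P)) => i; have [_ _ _ /(_ k i) [_ [[_ xE _ _] _]]] := algo.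
  rewrite [LHS]xE submxcolB submxcol_mxdiag_scalar submxcolB -!/(xblk _ _).
  by rewrite scalerBr scalerBl scale1r opprB addrA addrAC.
- apply: yblkP => i; have [_ _ _ /(_ k i) [_ [[_ _ _ yE] _]]] := algo.
  rewrite yE !yblkB [yblk (Gam_mx _ *m _) i](submxcol_mxdiag_scalar (p_ := fun=> d)).
  rewrite mulmxBr Zh_succ -!Lam_Z -/(yblk _ _) yblkB.
  by apply/colP => j; rewrite ![in RHS]mxE ![in LHS]mxE; ring.
Qed.

Lemma xh_in_Omega k : in_Omega (xh k).
Proof.
move=> i; have [_ _ _ /(_ k i) [[_ v_subdiff _] _]] := algo.
exact: phik_subdiff_Omega v_subdiff.
Qed.

Lemma Yh_in_Kpolar k : in_Kpolar (Yh k).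
Proof.
move=> i; have [_ _ _ /(_ k i) [_ [[-> _ _ _] _]]] := algo.
exact: Kpolar_projKpolar.
Qed.

Hypothesis P_convex : convex_problem P.
Hypothesis theta0 : forall i, 0 < theta i.
Hypothesis alpha0 : forall i, 0 < alpha i.
Hypothesis gamma0 : forall i, 0 < gamma i.
Hypothesis beta0 : 0 < beta.

Lemma agents_vi k x' Y' : in_Omega x' -> in_Kpolar Y' ->
  0 <= lagrangian x' (Yh k) - lagrangian (xh k) Y'
    + inner (xh k - x') (mxdiag_scalar (pn P) (fun i => (alpha i)^-1) *m (x k - xh k) + v k)
    + inner (Yh k - Y')
        (mxdiag_scalar (fun=> d) (fun i => (gamma i)^-1) *m (Y k - Yh k) - Lam k).
Proof.
move=> Ox' KY'; rewrite (inner_submxcol (xh k - x')).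
rewrite (inner_submxcol (p_ := fun=> d) (Yh k - Y')) -sumrB -!big_split/=.
apply: sumr_ge0 => i _; rewrite [submxcol (_ *m _ + _) _]submxcolD.
rewrite !submxcolB !submxcol_mxdiag_scalar !submxcolB.
have [_ _ _ /(_ k i) [[_ v_subdiff _] [[yhE _ _ _] _]]] := algo.
have primal := agent_primal_vi alpha0 gamma0 P_convex v_subdiff (Ox' i).
have dual := projKpolar_step_vi (gamma0 i) yhE (KY' i).
rewrite /dual_step -yhE in primal.
by rewrite -!/(xblk _ _) -!/(yblk _ _); lra.
Qed.

Lemma prediction_vi k x' Y' Z' : in_Omega x' -> in_Kpolar Y' ->
  0 <= lagrangian x' (Yh k) - lagrangian (xh k) Y'
    - inner (Ubold U *m Yh k) Z' + inner (Ubold U *m Y') (Zh k)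
    + inner (xih k - stack x' Y' Z') (Q *m (xi k - xih k) + V k).
Proof.
move=> Ox' KY'; have vi := agents_vi k Ox' KY'.
rewrite innerDr !stackB inner_stack_Q//.
have -> : beta^-1 * inner (Zh k - Z') (Z k - Zh k) =
    inner (Ubold U *m Yh k) Z' - inner (Ubold U *m Yh k) (Zh k).
  rewrite {2}Zh_step opprD addNKr innerNr innerZr mulrN mulrA mulVf ?gt_eqF// mul1r.
  by rewrite innerBl !(innerC _ (Ubold U *m Yh k)) opprB.
have -> : inner (Ubold U *m (Yh k - Y')) (Z k - Zh k) = inner (Yh k - Y') (Lam k)
    - (inner (Ubold U *m Yh k) (Zh k) - inner (Ubold U *m Y') (Zh k)).
  by rewrite innerBr {1}inner_mulmxl -Lam_Z mulmxBr (innerBl (Ubold U *m Yh k)).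
rewrite /stack inner_col_mx inner0r addr0.
by move: vi; rewrite (innerDr _ (v k)) (innerBr _ (Lam k)); lra.
Qed.

Lemma dpmm_descent k xs : Phi_zeros U xs ->
  sqnormA H (xi k.+1 - xs) <= sqnormA H (xi k - xs) - sqnormA D (xi k - xih k)
    + 2 * inner (xih k - xs) (V k).
Proof.
move=> /Phi_zerosP[Ox KY UY saddle]; rewrite xi_step.
have vi : 0 <= inner (xih k - xs) (Q *m (xi k - xih k) + V k).
  have := prediction_vi k (dsubmx (dsubmx xs)) Ox KY.
  have := saddle _ _ (xh_in_Omega k) (Yh_in_Kpolar k).
  by rewrite UY inner0l stackK; lra.
exact: (correction_descent (H_mul_M U beta theta0 alpha0 gamma0)
  (H_sym U beta theta0 alpha0 gamma0) vi).
Qed.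

Hypothesis P_closed : closed_problem P.
Hypothesis theta2 : forall i, theta i < 2.
Hypothesis step_size : forall i, gamma i * beta < 1 / lambda_max (U^T *m U).
Hypothesis eps_summable : forall i, cvgn (series (eps i)).

Let eps_ge0 i k : 0 <= eps i k.
Proof. by case: algo => _ _ _ /(_ k i) [[]]. Qed.

Let eta k := \sum_i eps i k.

Let eta0 k : 0 <= eta k.
Proof. by apply: sumr_ge0 => i _; exact: eps_ge0. Qed.

Let eta_summable : cvgn (series eta).
Proof. exact: is_cvg_series_sum. Qed.

Lemma error_le k : inner (V k) (V k) <= eta k ^+ 2.
Proof.
rewrite inner_col_mx inner0l addr0 inner_submxcol.
apply: le_trans (sum_sqr_le _) => //; apply: ler_sum => i _.
have [_ _ _ /(_ k i) [[_ _ v_le] _]] := algo.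
by rewrite -enorm_sqr ler_pXn2r ?nnegrE ?sqrtr_ge0.
Qed.

Lemma error_cvg0 : V k @[k --> \oo] --> (0 : 'cV[R]_(nx P + (ny P + nz P r))).
Proof.
apply: cvg_inner_sub0; apply: (@squeeze_cvgr _ _ _ _ (cst 0) (fun k => eta k ^+ 2)).
- by apply: nearW => k /=; rewrite subr0 inner_ge0 error_le.
- exact: cvg_cst.
have eta_cvg := cvg_series_cvg_0 eta_summable.
by rewrite -[0](mulr0 0); under eq_fun do rewrite expr2; exact: cvgM.
Qed.

Lemma cluster_point_saddle f l : increasing_seq f ->
  xi (f k) @[k --> \oo] --> l -> xih (f k) @[k --> \oo] --> l -> Phi_zeros U l.
Proof.
move=> f_incr xi_l xih_l; apply/Phi_zerosP.
have [_ _ Z_cvg] := cvg_stack xi_l; have [xh_cvg Yh_cvg Zh_cvg] := cvg_stack xih_l.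
have UY0 : Ubold U *m usubmx (dsubmx l) = 0.
  have UYh k : Ubold U *m Yh k = beta^-1 *: (Zh k - Z k).
    by rewrite Zh_step addrC addKr scalerA mulVf ?scale1r// gt_eqF.
  have UYh_cvg0 : Ubold U *m Yh (f k) @[k --> \oo] --> (0 : 'cV[R]_(nz P r)).
    rewrite (funext (fun k => UYh (f k))) -(scaler0 _ beta^-1).
    by rewrite -(subrr (dsubmx (dsubmx l))); apply: cvgZl_tmp; exact: cvgB.
  have UYh_cvg : Ubold U *m Yh (f k) @[k --> \oo] --> Ubold U *m usubmx (dsubmx l).
    exact: cvg_mulmx.
  exact: (cvg_unique (@norm_hausdorff _ _) UYh_cvg UYh_cvg0).
split=> //.
- exact: (in_Omega_lim P_closed (fun k => xh_in_Omega (f k)) xh_cvg).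
- exact: (in_Kpolar_lim (fun k => Yh_in_Kpolar (f k)) Yh_cvg).
move=> x' Y' Ox' KY'; pose s' : 'cV[R]_(nx P + (ny P + nz P r)) := stack x' Y' 0.
pose residual k := inner (xih (f k) - s') (Q *m (xi (f k) - xih (f k)) + V (f k)).
have residual_cvg : residual @ \oo --> 0.
  have : Q *m (xi (f k) - xih (f k)) + V (f k) @[k --> \oo] --> Q *m (l - l) + 0.
    apply: cvgD; first by apply: cvg_mulmx; exact: cvgB.
    exact: (cvg_subseq f_incr error_cvg0).
  rewrite subrr mulmx0 addr0 -(inner0r (l - s')) => ?; apply: cvg_inner => //.
  by apply: cvgB => //; exact: cvg_cst.
rewrite -[leRHS]addr0.
apply: (closed_fun_le_lim (closed_fun_lagrangian P_closed KY') xh_cvg (c := fun k =>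
  lagrangian x' (Yh (f k)) + inner (Ubold U *m Y') (Zh (f k)) + residual k)) => [k|].
  by have := prediction_vi (f k) 0 Ox' KY'; rewrite inner0r /residual; lra.
apply: cvgD => //; apply: cvgD; first exact: cvg_lagrangian.
by apply: cvg_inner => //; exact: cvg_cst.
Qed.

Hypothesis Phi_solvable : Phi_zeros (P := P) U !=set0.

Let H_pos := pos_def_H U theta0 alpha0 gamma0 beta0.
Let D_pos := pos_def_D theta0 alpha0 gamma0 beta0 theta2 step_size.

Lemma dpmm_bounded : exists B, forall k, enorm (xi k) <= B.
Proof.
exact: (fejer_bounded H_pos D_pos eta0 eta_summable error_le
  (fun xs zs k => dpmm_descent k zs) Phi_solvable).
Qed.

Lemma dpmm_cvg : exists2 l, Phi_zeros U l & xi k @[k --> \oo] --> l.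
Proof.
exact: (fejer_cvg_mem H_pos D_pos eta0 eta_summable error_le
  (fun xs zs k => dpmm_descent k zs) cluster_point_saddle Phi_solvable).
Qed.

End Algorithm.

Theorem theorem1 (R : realType) (P : Problem R)
    (* (A1): graph, Laplacian-like matrix L = U^T U *)
    (E : rel 'I_(pm P)) (L : 'M[R]_(pm P)) (r : nat) (U : 'M[R]_(r, pm P))
    (* parameters and precisions *)
    (theta alpha gamma : 'I_(pm P) -> R) (beta : R) (eps : 'I_(pm P) -> nat -> R)
    (* iterates *)
    (x xh v : nat -> 'cV[R]_(nx P)) (Y Yh Lam : nat -> 'cV[R]_(ny P))
    (Z Zh : nat -> 'cV[R]_(nz P r)) :
  (2 <= pm P)%N ->
  (forall i, 1 <= pn P i)%N ->
  (* (A1) *)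
  symmetric E ->
  (forall i j, connect E i j) ->
  L^T = L ->
  (forall i j, i != j -> ~~ E i j -> L i j = 0) ->
  (forall w : 'cV[R]_(pm P), L *m w = 0 <-> exists c : R, w = c *: const_mx 1) ->
  L = U^T *m U ->
  row_free U ->
  U *m (const_mx 1 : 'cV[R]_(pm P)) = 0 ->
  (* (A2) *)
  (forall i, convex_fun (pf P i) /\ closed_fun (pf P i)) ->
  (forall i (j : 'I_(pq P)), convex_fun (fun u => pg P i u j 0)
                            /\ closed_fun (fun u => pg P i u j 0)) ->
  (forall i, (pOmega P i !=set0) /\ closed (pOmega P i) /\ convex_set_cV (pOmega P i)) ->
  (exists xo : 'cV[R]_(nx P), primal_optimal xo) ->
  (* (A3) Slater *)
  (exists xb : 'cV[R]_(nx P),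
     [/\ (forall i, interior (pOmega P i) (xblk xb i)),
         \sum_(i < pm P) (pA P i *m xblk xb i - pb P i) = 0 &
         forall j : 'I_(pq P), (\sum_(i < pm P) pg P i (xblk xb i)) j 0 < 0]) ->
  (* parameters *)
  0 < beta ->
  (forall i, [/\ 0 < theta i < 2, 0 < alpha i, 0 < gamma i &
                 0 < gamma i * beta < 1 / lambda_max L]) ->
  (forall i, cvgn (series (eps i))) ->
  (* the algorithm *)
  inexact_DPMM U L theta alpha gamma beta eps x xh v Y Yh Lam Z Zh ->
  let xi k := stack (x k) (Y k) (Z k) in
  let xih k := stack (xh k) (Yh k) (Zh k) in
  let V k : 'cV[R]_(nx P + (ny P + nz P r)) := col_mx (v k) 0 in
  let H := H_mx U theta alpha gamma beta in
  let D := D_mx U theta alpha gamma beta in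
  (* (a) *)
  (forall xs, Phi_zeros U xs -> forall k : nat,
     sqnormA H (xi k.+1 - xs)
       <= sqnormA H (xi k - xs) - sqnormA D (xi k - xih k)
          + 2 * inner (xih k - xs) (V k)) /\
  (* (b) *)
  (exists B : R, forall k, enorm (xi k) <= B) /\
  (* (c) *)
  (exists xinf, [/\ Phi_zeros U xinf, xi @ \oo --> xinf,
     primal_optimal (usubmx xinf) &
     exists yinf, usubmx (dsubmx xinf) = ones_kron yinf /\ dual_optimal yinf]).
Proof.
move=> m_ge2 _ _ _ _ _ kerL LU U_free _ f_cvx_closed g_cvx_closed Omega_cvx_closed
  xo_opt slater beta0 param eps_sum algo.
subst L; have m0 : (0 < pm P)%N by exact: leq_trans m_ge2.
have kerU : kernel_ones U by move=> w; rewrite -kerL mulmx_gram_eq0.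
have P_convex : convex_problem P.
  by split=> [i|i j|i]; [case: (f_cvx_closed i)|case: (g_cvx_closed i j)|
    case: (Omega_cvx_closed i) => _ []].
have P_closed : closed_problem P.
  by split=> [i|i j|i]; [case: (f_cvx_closed i)|case: (g_cvx_closed i j)|
    case: (Omega_cvx_closed i) => _ []].
have [theta0 theta2] : (forall i, 0 < theta i) /\ (forall i, theta i < 2).
  by split=> i; case: (param i) => /andP[].
have [alpha0 gamma0] : (forall i, 0 < alpha i) /\ (forall i, 0 < gamma i).
  by split=> i; case: (param i).
have step_size i : gamma i * beta < 1 / lambda_max (U^T *m U).
  by case: (param i) => _ _ _ /andP[].
have Phi_solvable := slater_saddle_point P_convex m0 kerU xo_opt slater.
split; [|split].
- by move=> *; exact: (dpmm_descent m0 U_free algo P_convex theta0 alpha0 gamma0 beta0).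
- exact: (dpmm_bounded m0 U_free algo P_convex theta0 alpha0 gamma0 beta0 theta2 step_size).
- have [l l_zero l_cvg] := dpmm_cvg m0 U_free algo P_convex theta0 alpha0 gamma0 beta0
    P_closed theta2 step_size eps_sum Phi_solvable.
  have [primal dual] := saddle_point_optimal m0 kerU ((Phi_zerosP U l).1 l_zero).
  by exists l.
Qed.
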